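(* Let $m\ge4$ and let $\pi$ be a monomial APN permutation on $\mathbb{F}_2^m$, with $\deg(\pi)>2$, which induces an $\ell$-optimal bent function $f(x,y)=x\cdot\pi(y)+\delta_0(x)$ on $\mathbb{F}_2^m\times\mathbb{F}_2^m$. Then, provided that $\deg(\pi^{-1})>2$, its dual $f^*$ is also an $\ell$-optimal bent function and allows only 5-valued spectra decompositions. In particular, the inverse function $\pi(y)=y^{-1}$ on $\mathbb{F}_2^m$ (where by convention $\pi(0)=0$) is an example of such a permutation.
   Context: A monomial permutation is a permutation of the form $y\mapsto y^d$ of the finite field $\mathbb{F}_{2^m}$, identified with $\mathbb{F}_2^m$ as a vector space. $\cdot$ is the scalar product over $\mathbb{F}_2$ (in the finite field setting $x\cdot y$ may be taken to be the absolute trace $Tr(xy)$). $\delta_0(x)=\prod_{i=1}^m(x_i+1)$ is the indicator function of $\{0_m\}$. A map $F\colon\mathbb{F}_2^m\to\mathbb{F}_2^m$ is APN (almost perfect nonlinear) if for all $a\neq0_m$ and all $b$ the equation $F(x+a)+F(x)=b$ has $0$ or $2$ solutions $x$. $\deg$ of a map is the maximum algebraic degree of its coordinate functions. $\pi^{-1}$ in the condition $\deg(\pi^{-1})>2$ is the compositional inverse of $\pi$. For a Boolean function $g$ on $\mathbb{F}_2^n$, $W_g(u)=\sum_x(-1)^{g(x)+u\cdot x}$. For $n$ even, $g$ is bent if $W_g(u)=\pm2^{n/2}$ for all $u$; its dual $g^*$ is defined by $W_g(u)=2^{n/2}(-1)^{g^*(u)}$. With $D_aD_bg(x)=g(x+a+b)+g(x+a)+g(x+b)+g(x)$,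 an $\mathcal{M}$-subspace of $g$ is a linear subspace $U$ of $\mathbb{F}_2^n$ such that $D_aD_bg$ is identically $0$ for all $a,b\in U$; $\operatorname{ind}(g)$ is the maximal dimension of an $\mathcal{M}$-subspace. A bent function $g$ is $\ell$-optimal if $\operatorname{ind}(g)=1$. 4-decompositions: for a bent function $g$ on $\mathbb{F}_2^{n+2}$ and linearly independent $a,b\in\mathbb{F}_2^{n+2}$, let $V=\langle a,b\rangle^{\perp}$ ($n$-dimensional). The 4-decomposition of $g$ with respect to $V$ is the 4-tuple $(g_1,g_2,g_3,g_4)$ of restrictions of $g$ to the four cosets of $V$, viewed as Boolean functions in $n$ variables. It is known that the $g_i$ are either all bent ($W_{g_i}(u)=\pm2^{n/2}$ for all $u$), or all semi-bent ($W_{g_i}(u)\in\{0,\pm2^{n/2+1}\}$ for all $u$), or neither of these, in which case $W_{g_i}(u)\in\{0,\pm2^{n/2},\pm2^{n/2+1}\}$ for all $u$ and the decomposition is called 5-valued. ''Allows only 5-valued spectra decompositions'' means that for every $2$-dimensional subspace $\langle a,b\rangle$ the corresponding 4-decomposition is 5-valued (i.e. neither all bent nor all semi-bent).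
   Formalization: The inverse function is claimed to be APN only for odd m, since for even m it is not APN (the derivative equation with a=b=1 has the four solutions in F_4); all the other properties are asserted for every m≥4. *)

(* Defs.v *)
From mathcomp Require Import all_boot all_order all_fingroup all_algebra.

Set Implicit Arguments.
Unset Strict Implicit.
Unset Printing Implicit Defensive.

Import Order.TTheory GRing.Theory Num.Theory.
Local Open Scope ring_scope.

Notation vec n := 'rV['F_2]_n.
Notation boolfun n := (vec n -> 'F_2).

Definition dot n (x y : vec n) : 'F_2 := \sum_(i < n) x 0 i * y 0 i.

Definition delta0 n (x : vec n) : 'F_2 := \prod_(i < n) (x 0 i + 1).

(** Algebraic degree.  Every Boolean function has exactly one algebraic normal
    form, so the existential in [algdeg] ranges over a single family [c].  The
    constant functions, including 0, get degree 0. *)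

Definition is_anf n (g : boolfun n) (c : {ffun {set 'I_n} -> 'F_2}) : bool :=
  [forall x : vec n, g x == \sum_(I : {set 'I_n}) c I * \prod_(i in I) x 0 i].

Definition algdeg n (g : boolfun n) : nat :=
  \max_(I : {set 'I_n} |
        [exists c : {ffun {set 'I_n} -> 'F_2}, is_anf g c && (c I != 0)]) #|I|.

Definition map_deg n m (G : vec n -> vec m) : nat :=
  \max_(i < m) algdeg (fun x => G x ord0 i).

Definition APN m (G : vec m -> vec m) : Prop :=
  forall a b : vec m, a != 0 ->
    let N := #|[set x : vec m | G (x + a) + G x == b]| in N = 0%N \/ N = 2%N.

(** [phi] is the identification of the field [F] with the vector space F_2^m. *)
Definition monomial (F : finFieldType) m (phi : F -> vec m)
    (G : vec m -> vec m) : Prop :=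
  exists d : nat, forall y : F, G (phi y) = phi (y ^+ d).

Definition walsh n (g : boolfun n) (u : vec n) : int :=
  \sum_(x : vec n) (-1) ^+ (g x + dot u x)%R.

Definition bent n (g : boolfun n) : Prop :=
  ~~ odd n /\
  forall u, walsh g u = 2 ^+ n./2 \/ walsh g u = - 2 ^+ n./2.

Definition semibent n (g : boolfun n) : Prop :=
  ~~ odd n /\
  forall u, [\/ walsh g u = 0, walsh g u = 2 ^+ n./2.+1
              | walsh g u = - 2 ^+ n./2.+1].

Definition is_dual n (g gs : boolfun n) : Prop :=
  forall u, walsh g u = 2 ^+ n./2 * (-1) ^+ (gs u).

Definition D2 n (a b : vec n) (g : boolfun n) (x : vec n) : 'F_2 :=
  g (x + a + b) + g (x + a) + g (x + b) + g x.

(** A linear subspace of F_2^n is the row space of a square matrix. *)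
Definition M_subspace n (g : boolfun n) (U : 'M['F_2]_n) : bool :=
  [forall a : vec n, forall b : vec n,
    (a <= U)%MS && (b <= U)%MS ==> [forall x : vec n, D2 a b g x == 0]].

Definition ind n (g : boolfun n) : nat :=
  \max_(U : 'M['F_2]_n | M_subspace g U) \rank U.

Definition l_optimal n (g : boolfun n) : Prop := bent g /\ ind g = 1%N.

(** V = <a, b>^perp, as the row space of a square matrix. *)
Definition perp2 n (a b : vec n) : 'M['F_2]_n := kermx (col_mx a b)^T.

Lemma perp2P n (a b v : vec n) :
  (v <= perp2 a b)%MS = (dot a v == 0) && (dot b v == 0).
Proof.
have dotE (x y : vec n) : y *m x^T = (dot x y)%:M.
  apply/rowP=> i; rewrite !ord1 !mxE eqxx mulr1n.
  by apply: eq_bigr => j _; rewrite !mxE mulrC.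
have sc0 (c : 'F_2) : ((c%:M : 'M_1) == 0) = (c == 0).
  apply/eqP/eqP => [/matrixP/(_ 0 0)|->]; last by rewrite raddf0.
  by rewrite !mxE eqxx mulr1n.
by rewrite sub_kermx tr_col_mx mul_mx_row !dotE row_mx_eq0 !sc0.
Qed.

Lemma rank_perp2 n (a b : vec n) :
  row_free (col_mx a b) -> \rank (perp2 a b) = (n - 2)%N.
Proof. by rewrite mxrank_ker mxrank_tr => /eqP ->. Qed.

(** The restriction of [g] to the coset c + V, read in the coordinates of a
    basis of V; when [a] and [b] are independent it has n - 2 variables
    (lemma [rank_perp2]).  Changing the basis or the representative [c] of the
    coset only permutes the Walsh coefficients and changes their signs. *)
Definition restr4 n (g : boolfun n) (a b c : vec n) :
    boolfun (\rank (perp2 a b)) :=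
  fun z => g (c + z *m row_base (perp2 a b)).
Arguments restr4 {n} g a b c z.

(** Neither are the four restrictions all bent, nor are they all semi-bent;
    the four cosets of V are enumerated (with repetition) by all c. *)
Definition five_valued n (g : boolfun n) (a b : vec n) : Prop :=
  ~ (forall c, bent (restr4 g a b c)) /\
  ~ (forall c, semibent (restr4 g a b c)).

Definition only_five_valued n (g : boolfun n) : Prop :=
  forall a b : vec n, row_free (col_mx a b) -> five_valued g a b.

(** f (x, y) = x . pi(y) + delta_0(x), with F_2^m x F_2^m seen as F_2^(m + m). *)
Definition bent_of m (pi : vec m -> vec m) : boolfun (m + m) :=
  fun v => dot (lsubmx v) (pi (rsubmx v)) + delta0 (lsubmx v).

(* Main.v *)
Require Import Defs.
From mathcomp Require Import all_boot all_order all_fingroup all_algebra.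
From mathcomp Require Import finfield ring zify.

Import Order.TTheory GRing.Theory Num.Theory.
Local Open Scope ring_scope.

Set Implicit Arguments.
Unset Strict Implicit.
Unset Printing Implicit Defensive.

(** Write f(x, y) = x . p(y) + delta_0(x).  Summing over x first shows that
    f is bent with dual y . p^-1(x) + delta_0(y), which is f for p^-1 with the
    two halves of the variables exchanged ([walsh_bent_of], [dual_bent_of]).
    Everything then reduces to second derivatives.

    - A bent function has index 1 as soon as none of its second derivatives in
      independent directions is identically 0 ([ind_eq1]).
    - If the restrictions of a bent function to the cosets of <a, b>^perp are
      all bent, then D_a D_b of its dual is the constant 1; if they are all
      semi-bent, it is the constant 0.  Indeed a Walsh coefficient of the
      restriction to <a, b>^perp is the average of four Walsh coefficients of
      the function, that is, up to a factor, of four signs given by the dual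
      ([walsh_restr4], [five_valued_of_dual]).

    So the dual f^* is optimal if no D_a D_b f^* is 0, and has only 5-valued
    decompositions if no D_a D_b f is constant.  By [D2_bent_of_not_const],
    D_a D_b f = c forces either D_a' D_b' p = 0 for some independent a', b', or
    b' . D_a' p = c for some non-zero a', b'.

    For an APN permutation p the former never happens, and the latter does not
    happen for c = 0: the 2^(m-1) values of D_a' p are non-zero, too many for
    a hyperplane ([APN_no_linear_structure0]).  Both facts apply to p^-1, which
    is again APN.

    The remaining case b' . D_a' p = 1 is where p(y) = y^d is used.  Write y^d
    as y^S, the product of the conjugates y^(2^s) for s in the set S of binary
    digits of d reduced modulo 2^m - 1.  Rescaling gives Tr(e ((y + 1)^S + y^S)) = 1 for some e; by
    Frobenius e^2 has the same property, and the case c = 0 applied to e + e^2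
    gives e = 1.  Comparing coefficients of the polynomial in y, every
    non-empty R has an even number of cyclic shifts properly contained in S,
    and a parity argument on singletons, pairs and sets S minus a point shows
    #|S| <= 2 ([crooked_mono_quadratic]), so that p is at most quadratic.

    For the inverse function, derivatives of order 1, 2, 3 have explicit
    non-vanishing expressions ([inv_D1], [inv_D2], [inv_D3]); this excludes
    D_a D_b p = 0 and degree at most 2.  Here S is the complement of {0}, and
    the comparison of coefficients excludes every constant b . D_a p, whether
    or not p is APN ([inverse_trace_coef]). *)

(** * Vectors over F_2 *)

Lemma F2_cases (c : 'F_2) : c = 0 \/ c = 1.
Proof.
by case: c => [[|[|k]] hk]; [left|right|]; try apply: val_inj.
Qed.

Lemma F2_neq (x c : 'F_2) : x != c -> x = c + 1.
Proof.
by case: (F2_cases x) => ->; case: (F2_cases c) => -> // _; apply: val_inj.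
Qed.

Lemma addFF (c : 'F_2) : c + c = 0.
Proof. by case: (F2_cases c) => ->; apply: val_inj. Qed.

Lemma vecDD n (x : vec n) : x + x = 0.
Proof. by apply/rowP=> i; rewrite !mxE addFF. Qed.

Lemma vecN n (x : vec n) : - x = x.
Proof. by apply/eqP; rewrite eq_sym -addr_eq0 vecDD. Qed.

Lemma vecDK n (y x : vec n) : x + y + y = x.
Proof. by rewrite -addrA vecDD addr0. Qed.

Lemma vecD_eq0 n (x y : vec n) : (x + y == 0) = (x == y).
Proof. by rewrite addr_eq0 vecN. Qed.

Lemma dotC n (x y : vec n) : dot x y = dot y x.
Proof. by apply: eq_bigr => i _; rewrite mulrC. Qed.

Lemma dotDl n (x y z : vec n) : dot (x + y) z = dot x z + dot y z.
Proof. by rewrite -big_split; apply: eq_bigr => i _; rewrite mxE mulrDl. Qed.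

Lemma dotDr n (x y z : vec n) : dot z (x + y) = dot z x + dot z y.
Proof. by rewrite !(dotC z) dotDl. Qed.

Lemma dot0v n (x : vec n) : dot 0 x = 0.
Proof. by apply: big1 => i _; rewrite mxE mul0r. Qed.

Lemma dotv0 n (x : vec n) : dot x 0 = 0.
Proof. by rewrite dotC dot0v. Qed.

Lemma dot_delta n (x : vec n) i : dot x (delta_mx 0 i) = x 0 i.
Proof.
rewrite /dot (bigD1 i) //= big1 ?addr0 ?mxE ?eqxx ?mulr1 // => j ji.
by rewrite mxE (negPf ji) andbF mulr0.
Qed.

Lemma dot_nondeg n (x : vec n) : (forall y, dot x y = 0) -> x = 0.
Proof. by move=> h; apply/rowP=> i; rewrite -dot_delta h mxE. Qed.

Lemma card_vec n : #|{: vec n}| = (2 ^ n)%N.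
Proof. by rewrite card_mx card_Fp // mul1n. Qed.

Lemma exists_notin (T : finType) (s : seq T) :
  (size s < #|T|)%N -> exists x, x \notin s.
Proof.
move=> hs; apply/existsP; apply: contraTT hs => /existsPn h.
rewrite -leqNgt; apply: leq_trans (card_size s).
by apply: subset_leq_card; apply/subsetP => x _; have := h x; rewrite negbK.
Qed.

Lemma delta0E n (x : vec n) : delta0 x = (x == 0)%:R.
Proof.
rewrite /delta0; case: (eqVneq x 0) => [->|nx].
  by rewrite big1 // => i _; rewrite mxE add0r.
have [i xi] : exists i, x 0 i != 0.
  by apply/existsP; apply: contraNT nx => /existsPn h; apply/eqP/rowP=> i;
     rewrite mxE; apply/eqP; have := h i; rewrite negbK.
by rewrite (bigD1 i) //= (F2_neq xi) add0r addFF mul0r.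
Qed.

(** * Second derivatives of x . p(y) + delta_0(x) *)

Lemma D2C n (a b : vec n) g x : D2 a b g x = D2 b a g x.
Proof. by rewrite /D2 -!addrA (addrC a b); congr (_ + _); rewrite addrCA. Qed.

Lemma D2_shear n (a b : vec n) g x : D2 (a + b) b g x = D2 a b g x.
Proof.
by rewrite /D2 !addrA vecDK (addrC (g (x + a))).
Qed.

Lemma D2_dep n (a b : vec n) g x :
  [|| a == 0, b == 0 | a == b] -> D2 a b g x = 0.
Proof.
have h0 c : D2 0 c g x = 0 by rewrite /D2 addr0 -addrA addFF.
case/or3P => /eqP->; rewrite ?h0 // ?(D2C _ 0) ?h0 //.
by rewrite -D2_shear vecDD h0.
Qed.

(** By [D2_bent_of_not_const], the negations of this and of the next property
    are the only ways for a second derivative of x . p(y) + delta_0(x) in two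
    independent directions to be constant. *)
Definition no_flat_pair m (p : vec m -> vec m) : Prop :=
  forall a b, a != 0 -> b != 0 -> a != b ->
    ~ forall y, p (y + a + b) + p (y + a) + p (y + b) + p y = 0.

(** A direction along which the derivative of a Boolean function is constant is
    known as a linear structure; here the functions are the components b . p. *)
Definition no_linear_structure m (p : vec m -> vec m) (c : 'F_2) : Prop :=
  forall a b, a != 0 -> b != 0 -> ~ forall y, dot b (p (y + a) + p y) = c.

Lemma D2_bent_of m (p : vec m -> vec m) a b x y :
  D2 a b (bent_of p) (row_mx x y) =
    dot x (p (y + rsubmx a + rsubmx b) + p (y + rsubmx a)
             + p (y + rsubmx b) + p y)
    + dot (lsubmx a) (p (y + rsubmx a + rsubmx b) + p (y + rsubmx a))
    + dot (lsubmx b) (p (y + rsubmx a + rsubmx b) + p (y + rsubmx b))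
    + D2 (lsubmx a) (lsubmx b) (@delta0 m) x.
Proof.
rewrite /D2 /bent_of !linearD /= !row_mxKl !row_mxKr !dotDl !dotDr.
ring.
Qed.

Lemma D2_delta0_not_affine m (a b : vec m) : (4 <= m)%N ->
  a != 0 -> b != 0 -> a != b ->
  exists u v, D2 a b (@delta0 m) (u + v) + D2 a b (@delta0 m) u
                + D2 a b (@delta0 m) v + D2 a b (@delta0 m) 0 <> 0.
Proof.
move=> hm na nb nab.
have h16 : (16 <= #|{: vec m}|)%N by rewrite card_vec (leq_pexp2l (m := 2) (n1 := 4)).
(* The second derivative is the indicator of the span [s] of a and b; the
   points u, v, u + v are chosen outside [s], which 2^m >= 16 allows. *)
pose s := [:: 0; a; b; a + b].
have eqs : [/\ (a + b == 0) = false, (a + b == a) = false & (a + b == b) = false].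
  split; first by rewrite vecD_eq0 (negPf nab).
    by rewrite -vecD_eq0 (addrC a) vecDK (negPf nb).
  by rewrite -vecD_eq0 vecDK (negPf na).
have [e0 ea eb] := eqs.
have D2E x : D2 a b (@delta0 m) x = (x \in s)%:R.
  rewrite /D2 !delta0E !inE -[x + a + b]addrA !vecD_eq0 !(eq_sym _ (a + b)).
  have [->|n0] := eqVneq x 0.
    by rewrite e0 !(eq_sym 0) (negPf na) (negPf nb) !add0r.
  have [->|n1] := eqVneq x a; first by rewrite ea (negPf nab) !addr0 add0r.
  have [->|n2] := eqVneq x b; first by rewrite eb !addr0 !add0r.
  by rewrite !addr0.
have [u us] : exists u, u \notin s by apply: exists_notin; apply: leq_trans h16.
have [v vs] : exists v, v \notin s ++ [seq u + t | t <- s].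
  by apply: exists_notin; apply: leq_trans h16; rewrite size_cat size_map.
move: vs; rewrite mem_cat negb_or => /andP[vs vus].
have uvs : u + v \notin s.
  apply: contra vus => uvs; apply/mapP; exists (u + v) => //.
  by rewrite addrA vecDD add0r.
by exists u, v; rewrite !D2E (negPf us) (negPf vs) (negPf uvs) inE eqxx !add0r.
Qed.

(** Along [a] and [b] the second derivative of x . p(y) + delta_0(x) is affine
    in x up to the second derivative of delta_0, which is the indicator of the
    span of the x-parts of [a] and [b] when these are independent, hence not
    affine.  Otherwise a shear makes the x-part of [a] vanish, and being
    constant forces both the x-coefficient D_a D_b p and the constant term
    b . D_a p to be constant. *)
Lemma D2_bent_of_not_const m (p : vec m -> vec m) (c : 'F_2) :
    (4 <= m)%N -> no_flat_pair p -> no_linear_structure p c ->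
  forall a b : vec (m + m), a != 0 -> b != 0 -> a != b ->
    ~ forall x, D2 a b (bent_of p) x = c.
Proof.
move=> hm flat lin.
have left0 (a b : vec (m + m)) : lsubmx a = 0 -> a != 0 -> b != 0 -> a != b ->
    ~ forall x, D2 a b (bent_of p) x = c.
  rewrite -[a]hsubmxK -[b]hsubmxK; move: (lsubmx a) (rsubmx a) (lsubmx b) (rsubmx b).
  move=> {a b} a1 a2 b1 b2; rewrite row_mxKl => -> na nb nab h.
  have na2 : a2 != 0 by apply: contra na => /eqP->; rewrite row_mx0.
  have E x y := h (row_mx x y).
  have {}E x y : dot x (p (y + a2 + b2) + p (y + a2) + p (y + b2) + p y)
      + dot b1 (p (y + a2 + b2) + p (y + b2)) = c.
    rewrite -(E x y) D2_bent_of !row_mxKl !row_mxKr dot0v addr0.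
    by rewrite (@D2_dep _ 0) ?eqxx // addr0.
  have E0 y : dot b1 (p (y + a2 + b2) + p (y + b2)) = c.
    by rewrite -(E 0 y) dot0v add0r.
  have flat0 y : p (y + a2 + b2) + p (y + a2) + p (y + b2) + p y = 0.
    apply: dot_nondeg => x; rewrite dotC; apply: (@addIr _ c).
    by rewrite -{1}(E0 y) E add0r.
  have [b20|nb2] := eqVneq b2 0.
    apply: (lin a2 b1) => // [|y].
      by apply: contra nb => /eqP->; rewrite b20 row_mx0.
    by rewrite -(E0 y) b20 !addr0.
  have [ab2|nab2] := eqVneq a2 b2; last exact: (flat a2 b2).
  apply: (lin a2 b1) => // [|y].
    by apply: contra nab => /eqP->; rewrite ab2.
  by rewrite -(E0 y) -ab2 vecDK addrC.
move=> a b na nb nab h.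
have [a10|na1] := eqVneq (lsubmx a) 0; first exact: (left0 a b).
have [b10|nb1] := eqVneq (lsubmx b) 0.
  by apply: (left0 b a) => // [|x]; rewrite 1?eq_sym // D2C.
have [ab1|nab1] := eqVneq (lsubmx a) (lsubmx b).
  apply: (left0 (a + b) b) => // [||| x]; last by rewrite D2_shear.
  - by rewrite linearD /= ab1 vecDD.
  - by rewrite vecD_eq0.
  - by apply: contra na => /eqP ab; rewrite -(vecDK b a) ab vecDD.
have [u [v]] := D2_delta0_not_affine hm na1 nb1 nab1.
set d := D2 _ _ _ => nuv; apply: nuv.
pose A (x : vec m) := dot x (p (0 + rsubmx a + rsubmx b) + p (0 + rsubmx a)
             + p (0 + rsubmx b) + p 0).
pose B := dot (lsubmx a) (p (0 + rsubmx a + rsubmx b) + p (0 + rsubmx a))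
    + dot (lsubmx b) (p (0 + rsubmx a + rsubmx b) + p (0 + rsubmx b)).
have dE x : d x = c + A x + B.
  rewrite -(h (row_mx x 0)) D2_bent_of -/(A x) -/d -[_ + _ + dot _ _]addrA -/B.
  have -> : A x + B + d x + A x + B = d x + (A x + A x) + (B + B) by ring.
  by rewrite !addFF !addr0.
have AD : A (u + v) = A u + A v by rewrite /A dotDl.
have A0 : A 0 = 0 by rewrite /A dot0v.
rewrite !dE AD A0.
have -> : c + (A u + A v) + B + (c + A u + B) + (c + A v + B) + (c + 0 + B)
  = (c + c) + (c + c) + (A u + A u) + (A v + A v) + (B + B) + (B + B) by ring.
by rewrite !addFF.
Qed.

(** * The index of a Boolean function *)

Lemma row_free_pair n (a b : vec n) :
  row_free (col_mx a b) -> [/\ a != 0, b != 0 & a != b].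
Proof.
move=> fr.
have comb (s t : 'F_2) : s *: a + t *: b = 0 -> s = 0 /\ t = 0.
  rewrite -!mul_scalar_mx -mul_row_col => /eqP.
  rewrite mulmx_free_eq0 // row_mx_eq0 => /andP[/eqP/matrixP h1 /eqP/matrixP h2].
  by have := h1 0 0; have := h2 0 0; rewrite !mxE eqxx !mulr1n.
split; apply/eqP => e.
- by have [] // : (1 : 'F_2) = 0 /\ (0 : 'F_2) = 0; apply: comb;
     rewrite e scaler0 scale0r addr0.
- by have [] // : (0 : 'F_2) = 0 /\ (1 : 'F_2) = 0; apply: comb;
     rewrite e scaler0 scale0r addr0.
- by have [] // : (1 : 'F_2) = 0 /\ (1 : 'F_2) = 0; apply: comb;
     rewrite e scale1r vecDD.
Qed.

Lemma ind_eq1 n (g : boolfun n) : (0 < n)%N ->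
    (forall a b, a != 0 -> b != 0 -> a != b -> ~ forall x, D2 a b g x = 0) ->
  ind g = 1%N.
Proof.
case: n g => // n g _ hg; apply/eqP; rewrite eqn_leq; apply/andP; split.
  apply/bigmax_leqP => U /forallP MU; rewrite leqNgt; apply/negP => rU.
  pose a := row (Ordinal (ltnW rU)) (row_base U).
  pose b := row (Ordinal rU) (row_base U).
  have sub i : (row i (row_base U) <= U)%MS.
    by have := row_sub i (row_base U); rewrite eq_row_base.
  have fr : row_free (row_base U) := row_base_free U.
  have rowE i : row i (row_base U) = delta_mx 0 i *m row_base U by rewrite rowE.
  have inj := row_free_inj fr.
  have dn0 (i : 'I_(\rank U)) : delta_mx 0 i != 0 :> 'rV['F_2]_(\rank U).
    by apply/eqP=> /matrixP/(_ 0 i)/eqP; rewrite !mxE !eqxx.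
  apply: (hg a b); rewrite /a /b ?rowE ?mulmx_free_eq0 //.
    rewrite (inj_eq (inj _)); apply/eqP=> /matrixP/(_ 0 (Ordinal rU))/eqP.
    by rewrite !mxE !eqxx.
  have /forallP/(_ b)/implyP := MU a; rewrite !sub => /(_ isT)/forallP h x.
  by rewrite -!rowE; apply/eqP.
have := @leq_bigmax_cond _ (M_subspace g) (fun U => \rank U) (delta_mx 0 0).
rewrite mxrank_delta; apply.
apply/forallP=> a; apply/forallP=> b; apply/implyP => /andP[ha hb].
have mem (v : vec n.+1) : (v <= delta_mx (0 : 'I_n.+1) (0 : 'I_n.+1))%MS ->
    v = 0 \/ v = delta_mx 0 0.
  move=> /submxP[w ->].
  have -> : w *m delta_mx 0 0 = w 0 0 *: (delta_mx 0 0 : vec n.+1).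
    apply/rowP => j; rewrite !mxE (bigD1 0) //= big1 ?addr0 ?mxE ?eqxx //.
    by move=> i ni; rewrite mxE (negPf ni) mulr0.
  by case: (F2_cases (w 0 0)) => ->; rewrite ?scale0r ?scale1r; [left|right].
apply/forallP => x; apply/eqP/D2_dep.
by case: (mem a ha) (mem b hb) => -> [] ->; rewrite !eqxx ?orbT.
Qed.

(** * Walsh transforms *)

Definition chi (c : 'F_2) : int := (-1) ^+ c.

Lemma chiD c d : chi (c + d) = chi c * chi d.
Proof. by case: (F2_cases c) => ->; case: (F2_cases d) => ->. Qed.

Lemma chi_inj : injective chi.
Proof. by move=> c d; case: (F2_cases c) => ->; case: (F2_cases d) => ->. Qed.

Lemma chi_delta0 n (x : vec n) : chi (delta0 x) = 1 - (x == 0)%:R *+ 2.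
Proof. by rewrite delta0E; case: eqP. Qed.

Lemma sum_chi_dot n (a : vec n) : \sum_x chi (dot a x) = 2 ^+ n * (a == 0)%:R.
Proof.
have [->|na] := eqVneq a 0.
  rewrite (eq_bigr (fun=> 1)) => [|x _]; last by rewrite dot0v.
  by rewrite sumr_const card_vec mulr1 natrX.
have [i ai] : exists i, a 0 i != 0.
  by apply/existsP; apply: contraNT na => /existsPn h; apply/eqP/rowP=> i;
     rewrite mxE; apply/eqP; have := h i; rewrite negbK.
have E : \sum_x chi (dot a x) = - \sum_x chi (dot a x).
  rewrite {1}(reindex_inj (addIr (delta_mx 0 i))) -sumrN /=.
  apply: eq_bigr => x _; rewrite dotDr dot_delta (F2_neq ai) add0r chiD.
  by rewrite mulrN1.
rewrite mulr0; apply/eqP; move/eqP: E.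
by rewrite -addr_eq0 -mulr2n mulrn_eq0.
Qed.

Definition swap m (u : vec (m + m)) : vec (m + m) := row_mx (rsubmx u) (lsubmx u).

Lemma swapK m : involutive (@swap m).
Proof. by move=> u; rewrite /swap row_mxKl row_mxKr hsubmxK. Qed.

Lemma swapD m (u v : vec (m + m)) : swap (u + v) = swap u + swap v.
Proof. by rewrite /swap !linearD /= add_row_mx. Qed.

Lemma dot_row_mx m (u : vec (m + m)) x y :
  dot u (row_mx x y) = dot (lsubmx u) x + dot (rsubmx u) y.
Proof.
rewrite /dot big_split_ord; congr (_ + _); apply: eq_bigr => i _.
  by rewrite row_mxEl mxE.
by rewrite row_mxEr mxE.
Qed.

Lemma dot_swap m (u v : vec (m + m)) : dot (swap u) (swap v) = dot u v.
Proof.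
by rewrite dot_row_mx /swap row_mxKl row_mxKr addrC -dot_row_mx hsubmxK.
Qed.

Lemma sum_row_mx m (G : vec (m + m) -> int) :
  \sum_v G v = \sum_y \sum_x G (row_mx x y).
Proof.
rewrite exchange_big pair_big /=.
rewrite (reindex (fun z : vec m * vec m => row_mx z.1 z.2)) //.
exists (fun v => (lsubmx v, rsubmx v)) => [[x y] _|v _] /=.
  by rewrite row_mxKl row_mxKr.
by rewrite hsubmxK.
Qed.

Lemma walsh_chi n (g : boolfun n) u : walsh g u = \sum_x chi (g x) * chi (dot u x).
Proof. by apply: eq_bigr => x _; rewrite -chiD. Qed.

(** Summing over x first leaves 2^m at the single y with p(y) = u_1, and the
    correction -2 contributed by delta_0 at x = 0 sums over y to a multiple of
    the indicator of u_2 = 0. *)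
Lemma walsh_bent_of m (p : {perm vec m}) u :
  walsh (bent_of p) u = 2 ^+ m * chi (bent_of (p^-1)%g (swap u)).
Proof.
have inner y : \sum_x chi (bent_of p (row_mx x y)) * chi (dot u (row_mx x y))
    = chi (dot (rsubmx u) y) * (2 ^+ m * (p y == lsubmx u)%:R - 2).
  transitivity (chi (dot (rsubmx u) y) *
      (\sum_x (chi (dot (p y + lsubmx u) x) - (x == 0)%:R *+ 2))).
    rewrite big_distrr; apply: eq_bigr => x _ /=.
    rewrite /bent_of row_mxKl row_mxKr dot_row_mx !chiD chi_delta0 dotDl chiD.
    rewrite (dotC x); have [->|_] := eqVneq x 0; last by rewrite mulr0n mul0rn; ring.
    by rewrite !dotv0 [chi 0]expr0 mulr1n; ring.
  congr (_ * _); rewrite big_split /= sum_chi_dot vecD_eq0 sumrN.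
  rewrite (bigD1 0) //= big1 ?eqxx ?addr0 // => x nx.
  by rewrite (negPf nx).
rewrite walsh_chi sum_row_mx (eq_bigr _ (fun y _ => inner y)).
have -> : \sum_y chi (dot (rsubmx u) y) * (2 ^+ m * (p y == lsubmx u)%:R - 2)
   = 2 ^+ m * (\sum_y chi (dot (rsubmx u) y) * (p y == lsubmx u)%:R)
     - 2 * \sum_y chi (dot (rsubmx u) y).
  rewrite !big_distrr -sumrB; apply: eq_bigr => y _ /=; ring.
rewrite (bigD1 ((p^-1)%g (lsubmx u))) //= permKV eqxx big1 => [|y ny].
  rewrite sum_chi_dot /bent_of /swap row_mxKl row_mxKr chiD chi_delta0.
  have [->|_] := eqVneq (rsubmx u) 0; last by rewrite mulr0n mul0rn mulr1n; ring.
  by rewrite dot0v [chi 0]expr0 mulr1n; ring.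
by rewrite -(inj_eq (@perm_inj _ p^-1%g)) permK (negPf ny) mulr0.
Qed.

Lemma half_double m : (m + m)./2 = m. Proof. by rewrite addnn doubleK. Qed.

Lemma dual_bent_of m (p : {perm vec m}) fs u :
  is_dual (bent_of p) fs -> fs u = bent_of (p^-1)%g (swap u).
Proof.
move=> /(_ u); rewrite walsh_bent_of half_double -/(chi (fs u)) => E.
by apply/esym/chi_inj/(mulfI _ E); rewrite expf_neq0.
Qed.

Lemma walsh_dual_bent_of m (p : {perm vec m}) fs u :
  is_dual (bent_of p) fs -> walsh fs u = 2 ^+ m * chi (bent_of p u).
Proof.
move=> dual; rewrite walsh_chi (reindex_inj (can_inj (@swapK m))).
rewrite (eq_bigr (fun x => chi (bent_of (p^-1)%g x) * chi (dot (swap u) x))).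
  by rewrite -walsh_chi walsh_bent_of swapK invgK.
by move=> x _; rewrite (dual_bent_of _ dual) swapK -{1}[u]swapK dot_swap.
Qed.

Lemma bent_of_chi n (g h : boolfun (n + n)) :
  (forall u, walsh g u = 2 ^+ n * chi (h u)) -> bent g.
Proof.
move=> W; split=> [|u]; first by rewrite addnn odd_double.
rewrite W half_double; case: (F2_cases (h u)) => ->; [left|right].
  by rewrite mulr1.
by rewrite mulrN1.
Qed.

Lemma bent_bent_of m (p : {perm vec m}) : bent (bent_of p).
Proof. exact: bent_of_chi (walsh_bent_of p). Qed.

(** The indicator of V = <a, b>^perp is the average of the four characters of
    <a, b>, so the Walsh transform of the restriction to V is the average of
    four Walsh coefficients of [g]. *)
Lemma walsh_restr4 n (g : boolfun n) (a b u : vec n) :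
  4 * walsh (restr4 g a b 0) (u *m (row_base (perp2 a b))^T) =
  walsh g u + walsh g (u + a) + walsh g (u + b) + walsh g (u + a + b).
Proof.
set B := row_base _.
have memB v : (dot a v == 0) && (dot b v == 0) = (v <= B)%MS.
  by rewrite eq_row_base perp2P.
have dotB z : dot (u *m B^T) z = dot u (z *m B).
  have dotE k (x y : vec k) : dot x y = (y *m x^T) 0 0.
    by rewrite !mxE; apply: eq_bigr => j _; rewrite !mxE mulrC.
  by rewrite !dotE trmx_mul trmxK mulmxA.
have -> : walsh (restr4 g a b 0) (u *m B^T)
    = \sum_(v | (dot a v == 0) && (dot b v == 0)) chi (g v) * chi (dot u v).
  rewrite walsh_chi (reindex_onto (fun z => z *m B) (fun v => v *m pinvmx B)) /=.
    apply: eq_big => [z|z _]; last by rewrite /restr4 add0r dotB.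
    rewrite memB submxMl /=.
    by rewrite mulmxKp ?eqxx // row_base_free.
  by move=> v; rewrite memB => h; apply: mulmxKpV.
rewrite !walsh_chi big_distrr -!big_split big_mkcond /=.
apply: eq_bigr => v _; rewrite !dotDl !chiD.
case: (F2_cases (dot a v)) => ->; case: (F2_cases (dot b v)) => -> /=;
  rewrite ?[chi 0]expr0 ?[chi 1]expr1; ring.
Qed.

(** With Walsh coefficients 2^m (-1)^f, the four-term average at u is +-2^(m-1)
    when f takes the value 1 an odd number of times on u + <a, b>, and lies in
    {0, +-2^m} otherwise.  The parity of this number is D_a D_b f(u). *)
Lemma five_valued_of_dual m (g f : boolfun (m + m)) (a b : vec (m + m)) :
    (1 < m)%N -> row_free (col_mx a b) ->
    (forall u, walsh g u = 2 ^+ m * chi (f u)) ->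
    (forall c, ~ forall x, D2 a b f x = c) ->
  five_valued g a b.
Proof.
case: m g f a b => [|[|m]] // g f a b _ fr W nconst.
have rk : (\rank (perp2 a b))./2 = m.+1.
  rewrite rank_perp2 // (_ : m.+2 + m.+2 - 2 = m.+1 + m.+1)%N ?half_double //.
  by rewrite addSn addnS subn2.
have avg u : 2 * walsh (restr4 g a b 0) (u *m (row_base (perp2 a b))^T) =
    2 ^+ m.+1 * (chi (f u) + chi (f (u + a)) + chi (f (u + b)) + chi (f (u + a + b))).
  apply: (@mulfI _ 2) => //; rewrite mulrA [2 * 2](_ : _ = 4) // walsh_restr4 !W.
  by rewrite !(exprS _ m.+1); ring.
have n0 : 2 ^+ m.+1 != 0 :> int by rewrite expf_neq0.
(* [avg] determines the sum of the four signs at u from the quotient t of the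
   Walsh coefficient of the restriction by 2^(m+1). *)
have parity u t S :
    2 ^+ m.+1 * S = 2 * walsh (restr4 g a b 0) (u *m (row_base (perp2 a b))^T) ->
    walsh (restr4 g a b 0) (u *m (row_base (perp2 a b))^T) = 2 ^+ m.+1 * t ->
    S = 2 * t.
  by move=> ES Et; apply: (mulfI n0); rewrite ES Et; ring.
have step u t := parity u t _ (esym (avg u)).
split=> h.
- apply: (nconst 1) => u; have [_ /(_ (u *m (row_base (perp2 a b))^T))] := h 0.
  rewrite rk /D2 => hW.
  have {hW} : exists2 t : int, (t == 1) || (t == - 1) &
      walsh (restr4 g a b 0) (u *m (row_base (perp2 a b))^T) = 2 ^+ m.+1 * t.
    by case: hW => ->; [exists 1|exists (-1)]; rewrite ?mulr1 ?mulrN1.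
  case=> t ht /step; move: ht.
  case: (F2_cases (f u)) => ->; case: (F2_cases (f (u + a))) => ->;
  case: (F2_cases (f (u + b))) => ->; case: (F2_cases (f (u + a + b))) => ->;
  by case/orP => /eqP-> // _; apply: val_inj.
- apply: (nconst 0) => u; have [_ /(_ (u *m (row_base (perp2 a b))^T))] := h 0.
  rewrite rk /D2 => hW.
  have {hW} : exists2 t : int, [|| t == 0, t == 2 | t == - 2] &
      walsh (restr4 g a b 0) (u *m (row_base (perp2 a b))^T) = 2 ^+ m.+1 * t.
    case: hW => ->; first by exists 0; rewrite ?mulr0.
      by exists 2; rewrite // -exprSr.
    by exists (- 2); rewrite // mulrN -exprSr.
  case=> t ht /step; move: ht.
  case: (F2_cases (f u)) => ->; case: (F2_cases (f (u + a))) => ->;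
  case: (F2_cases (f (u + b))) => ->; case: (F2_cases (f (u + a + b))) => ->;
  by case/or3P => /eqP-> // _; apply: val_inj.
Qed.

(** [fs] is the dual of [bent_of p], hence [bent_of p^-1] with the two halves
    exchanged: its second derivatives are governed by p^-1, and those of its
    own dual [bent_of p], which decide the 4-decompositions, by p. *)
Lemma dual_optimal_five_valued m (p : {perm vec m}) fs : (4 <= m)%N ->
    no_flat_pair p -> (forall c, no_linear_structure p c) ->
    no_flat_pair (p^-1)%g -> no_linear_structure (p^-1)%g 0 ->
  is_dual (bent_of p) fs -> l_optimal fs /\ only_five_valued fs.
Proof.
move=> hm flat lin flatV linV dual.
have W u := walsh_dual_bent_of u dual.
split; first split; first exact: bent_of_chi W.
  apply: ind_eq1 => [|a b na nb nab h]; first by rewrite addn_gt0 (leq_trans _ hm).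
  have inj := can_inj (@swapK m).
  have swap0 : swap (0 : vec (m + m)) = 0.
    by rewrite /swap !linear0 row_mx0.
  apply: (D2_bent_of_not_const hm flatV linV (a := swap a) (b := swap b)).
  - by rewrite -swap0 (inj_eq inj).
  - by rewrite -swap0 (inj_eq inj).
  - by rewrite (inj_eq inj).
  move=> x; rewrite -(h (swap x)) /D2 !(dual_bent_of _ dual).
  by rewrite !swapD swapK.
move=> a b fr; apply: (five_valued_of_dual _ fr W) => [|c].
  by apply: leq_trans hm.
by have [na nb nab] := row_free_pair fr; apply: D2_bent_of_not_const.
Qed.

Lemma bent_of_optimal m (p : {perm vec m}) : (4 <= m)%N ->
  no_flat_pair p -> no_linear_structure p 0 -> l_optimal (bent_of p).
Proof.
move=> hm flat lin; split; first exact: bent_bent_of.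
apply: ind_eq1 => [|a b na nb nab]; first by rewrite addn_gt0 (leq_trans _ hm).
exact: D2_bent_of_not_const.
Qed.

(** * APN permutations *)

Lemma APN_inj m (p : vec m -> vec m) (a x y : vec m) : APN p -> a != 0 ->
  p (x + a) + p x = p (y + a) + p y -> y = x \/ y = x + a.
Proof.
move=> apn na E; pose N := [set z | p (z + a) + p z == p (x + a) + p x].
have xxa : x != x + a by rewrite -{1}[x]addr0 (inj_eq (addrI _)) eq_sym.
have yN : y \in N by rewrite inE E.
have sub : [set x; x + a] \subset N.
  apply/subsetP => z /set2P[]->; rewrite inE //.
  by rewrite vecDK addrC.
suff : y \in [set x; x + a] by move/set2P.
suff /eqP-> : [set x; x + a] == N by [].
rewrite eqEcard sub cards2 xxa.
by case: (apn a (p (x + a) + p x) na) => /= ->.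
Qed.

Lemma APN_of_inj m (p : vec m -> vec m) :
    (forall a x y, a != 0 -> p (x + a) + p x = p (y + a) + p y ->
       y = x \/ y = x + a) ->
  APN p.
Proof.
move=> inj a b na /=; case: (set_0Vmem [set x | p (x + a) + p x == b]) => [->|[x]].
  by left; rewrite cards0.
rewrite inE => /eqP xb; right.
have xxa : x != x + a by rewrite -{1}[x]addr0 (inj_eq (addrI _)) eq_sym.
rewrite (_ : [set _ | _] = [set x; x + a]) ?cards2 ?xxa //.
apply/setP => y; rewrite inE; apply/eqP/set2P => [yb|[]-> //].
  by apply: inj => //; rewrite xb yb.
by rewrite vecDK addrC.
Qed.

Lemma APN_no_flat_pair m (p : {perm vec m}) : APN p -> no_flat_pair p.
Proof.
move=> apn a b na nb nab /(_ 0); rewrite !add0r => E.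
have E' : p (0 + a) + p 0 = p (b + a) + p b.
  apply/eqP; rewrite -vecD_eq0 add0r (addrC b); apply/eqP; rewrite -[RHS]E.
  by rewrite addrC addrACA !addrA (addrC b a) (addrC (p a)) addrAC.
case: (APN_inj apn na E') => /eqP; rewrite ?add0r; first by rewrite (negPf nb).
by rewrite eq_sym (negPf nab).
Qed.

(** The four points y, y + a, y + b, y + a + b on which p^-1 sums to zero are
    the values of p on a second such quadruple. *)
Lemma APN_inv m (p : {perm vec m}) : APN p -> APN (p^-1)%g.
Proof.
move=> apn; apply: APN_of_inj => a x y na E.
set q := (p^-1)%g in E *.
have Kq z : p (q z) = z by rewrite /q permKV.
have [->|nxy] := eqVneq y x; [by left | right].
pose c := q (x + a) + q x.
have nc : c != 0.
  by rewrite vecD_eq0 (inj_eq perm_inj) -{2}[x]addr0 (inj_eq (addrI _)).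
have xc : q x + c = q (x + a) by rewrite /c addrC vecDK.
have yc : q y + c = q (y + a) by rewrite /c E addrC vecDK.
have E' : p (q x + c) + p (q x) = p (q y + c) + p (q y).
  by rewrite xc yc !Kq !(addrC _ a) !vecDK.
case: (APN_inj apn nc E') => [/perm_inj yx|]; first by rewrite yx eqxx in nxy.
by rewrite xc => /perm_inj.
Qed.

(** The 2^(m-1) values of D_a p are all non-zero, so they cannot fit into a
    hyperplane b^perp, which has only 2^(m-1) - 1 non-zero elements. *)
Lemma APN_no_linear_structure0 m (p : {perm vec m}) :
  APN p -> no_linear_structure p 0.
Proof.
move=> apn a b na nb h.
pose D y := p (y + a) + p y.
pose H := [set z | dot b z == 0].
have fib z : (#|[set y | D y == z]| <= 2)%N by case: (apn a z na) => /= ->.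
have [u bu] : exists u, dot b u != 0.
  apply/existsP; apply: contraNT nb => /existsPn e; apply/eqP/dot_nondeg => y.
  by apply/eqP; have := e y; rewrite negbK.
have cH : (#|H| * 2 = 2 ^ m)%N.
  rewrite muln2 -addnn -card_vec -(cardsC H); congr (_ + _)%N.
  rewrite -(card_imset H (addIr u)); apply: eq_card => z.
  rewrite !inE; apply/imsetP/idP => [[w]|nz].
    by rewrite inE => /eqP bw ->; rewrite dotDr bw add0r.
  exists (z + u); rewrite ?vecDK // inE dotDr (F2_neq nz) (F2_neq bu).
  by rewrite !add0r addFF.
have sub y : D y \in H :\ 0.
  rewrite !inE h eqxx andbT vecD_eq0 (inj_eq perm_inj).
  by rewrite -{2}[y]addr0 (inj_eq (addrI _)).
have : (#|{: vec m}| <= #|H :\ 0%R| * 2)%N.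
  have -> : #|{: vec m}| = (\sum_(y : vec m) 1)%N by rewrite sum1_card.
  rewrite (partition_big D (fun z => z \in H :\ 0)) => [|y _]; last exact: sub.
  apply: (@leq_trans (\sum_(z in H :\ 0%R) 2)%N); last by rewrite sum_nat_const.
  apply: leq_sum => z _.
  by apply: leq_trans (fib z); rewrite -sum1_card leq_eqVlt; apply/orP; left;
     apply/eqP/eq_bigl => y; rewrite inE.
have : 0 \in H by rewrite inE dotv0.
move=> H0; rewrite card_vec -cH (cardsD1 0 H) H0 leq_mul2r /=.
by rewrite add1n ltnn.
Qed.

(** * Algebraic degree *)

(** Evaluating at the indicator vector of [I] sums the coefficients of the
    subsets of [I], so they can be recovered by induction on #|I|. *)
Lemma is_anf_inj n (g : boolfun n) c d : is_anf g c -> is_anf g d -> c = d.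
Proof.
move=> /forallP gc /forallP gd; apply/ffunP => I.
have [k] := ubnP #|I|; elim: k I => // k IH I; rewrite ltnS => kI.
pose x : vec n := \row_i (i \in I)%:R.
have ev (e : {ffun {set 'I_n} -> 'F_2}) : is_anf g e ->
    g x = e I + \sum_(J : {set 'I_n} | J \proper I) e J.
  move=> /forallP/(_ x)/eqP->; rewrite (bigD1 I) //=; congr (_ + _).
    by rewrite big1 ?mulr1 // => i iI; rewrite mxE iI.
  rewrite big_mkcond [RHS]big_mkcond; apply: eq_bigr => J _ /=.
  rewrite properEneq; case: (J =P I) => //= _.
  case: ifP => [/subsetP JI|/subsetPn[i iJ nI]].
    by rewrite big1 ?mulr1 // => i /JI iI; rewrite mxE iI.
  by rewrite (bigD1 i) //= mxE (negPf nI) mul0r mulr0.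
have := ev d; rewrite (ev c); last exact/forallP.
move=> /(_ (introT forallP gd)).
rewrite (eq_bigr d) => [|J JI]; first exact: addIr.
by apply: IH; apply: leq_trans kI; apply: proper_card.
Qed.

(** There are as many coefficient families as Boolean functions, so uniqueness
    of the normal form yields existence. *)
Lemma is_anf_exists n (g : boolfun n) : exists c, is_anf g c.
Proof.
pose ev (c : {ffun {set 'I_n} -> 'F_2}) : {ffun vec n -> 'F_2} :=
  [ffun x : vec n => \sum_(I : {set 'I_n}) c I * \prod_(i in I) x 0 i].
have ev_inj : injective ev.
  move=> c d E; apply: (@is_anf_inj _ (ev c)).
    by apply/forallP => x; rewrite ffunE.
  by apply/forallP => x; rewrite E ffunE.
have [|h _ K] := inj_card_bij ev_inj.
  rewrite !card_ffun card_vec -[#|{set _}|]cardsT -powersetT card_powerset.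
  by rewrite cardsT !card_ord.
exists (h (finfun g)); apply/forallP => x.
by have /ffunP/(_ x) := K (finfun g); rewrite !ffunE => <-.
Qed.

Lemma algdeg_leq n (g : boolfun n) c k : is_anf g c ->
  (forall I, c I != 0 -> (#|I| <= k)%N) -> (algdeg g <= k)%N.
Proof.
move=> gc hk; apply/bigmax_leqP => I /existsP[d /andP[gd dI]].
by apply: hk; rewrite (is_anf_inj gc gd).
Qed.

Lemma leq_algdeg n (g : boolfun n) c I :
  is_anf g c -> c I != 0 -> (#|I| <= algdeg g)%N.
Proof.
move=> gc cI; apply: (leq_bigmax_cond (F := fun I : {set 'I_n} => #|I|)).
by apply/existsP; exists c; rewrite gc.
Qed.

Lemma D3_algdeg2 n (g : boolfun n) a b c x : (algdeg g <= 2)%N ->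
  D2 a b g (x + c) + D2 a b g x = 0.
Proof.
move=> deg; have [e ge] := is_anf_exists g.
have gE y : g y = \sum_(I : {set 'I_n}) e I * \prod_(i in I) y 0 i.
  by move/forallP/(_ y)/eqP: ge.
rewrite /D2 !gE -!big_split /= big1 // => I _; rewrite -!mulrDr.
have [->|eI] := eqVneq (e I) 0; first by rewrite mul0r.
apply: etrans (mulr0 (e I)); congr (_ * _).
have := leq_trans (leq_algdeg ge eI) deg.
rewrite leq_eqVlt ltnS leq_eqVlt ltnS leqn0 cards_eq0.
case/or3P => [/cards2P[i [j [ij ->]]]|/cards1P[i ->]|/eqP->].
- rewrite !(big_setU1 _ _) ?inE //= !big_set1 !mxE.
  set x' := x 0 j; set a' := a 0 j; set b' := b 0 j; set c' := c 0 j.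
  move: (x 0 i) (a 0 i) (b 0 i) (c 0 i) => y d f h.
  rewrite -[RHS](addFF (4 * (y * x') + 2 * (y * (a' + b' + c') + x' * (d + f + h))
     + 2 * (d * a' + f * b' + h * c')
     + (d * b' + f * a' + d * c' + h * a' + f * c' + h * b'))).
  ring.
- rewrite !big_set1 !mxE; move: (x 0 i) (a 0 i) (b 0 i) (c 0 i) => y d f h.
  rewrite -[RHS](addFF (4 * y + 2 * (d + f + h))); ring.
- by rewrite !big_set0 -(addFF (4 : 'F_2)); ring.
Qed.

Lemma D3_map_deg2 n m (G : vec n -> vec m) a b c x : (map_deg G <= 2)%N ->
  G (x + c + a + b) + G (x + c + a) + G (x + c + b) + G (x + c)
  + (G (x + a + b) + G (x + a) + G (x + b) + G x) = 0.
Proof.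
move=> deg; apply/rowP => i; rewrite !mxE.
apply: (@D3_algdeg2 _ (fun x => G x 0 i)); apply: leq_trans deg.
exact: (leq_bigmax (F := fun i => algdeg (fun x => G x ord0 i))).
Qed.

(** Expanding a product of #|S| sums over a basis gives monomials in at most
    #|S| distinct coordinates, since x^2 = x on F_2. *)
Lemma map_deg_prod_additive m (F : finFieldType) (phi : {additive F -> vec m.+1})
    (psi : vec m.+1 -> F) (I : finType) (S : {set I}) (L : I -> F -> F) :
    {morph psi : x y / x + y} -> (forall s, {morph L s : x y / x + y}) ->
  (map_deg (fun x => phi (\prod_(s in S) L s (psi x))%R) <= #|S|)%N.
Proof.
move=> psiD LD; apply/bigmax_leqP => i _.
have Lpsi s x y : L s (psi (x + y)) = L s (psi x) + L s (psi y) by rewrite psiD LD.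
have Lpsi0 s : L s (psi 0) = 0 by apply: (addIr (L s (psi 0))); rewrite -Lpsi !add0r.
pose e k : vec m.+1 := delta_mx 0 k.
pose fam := pfamily (ord0 : 'I_m.+1) (mem S) (fun=> predT).
pose co (f : {ffun I -> 'I_m.+1}) : 'F_2 :=
  phi (\prod_(s in S) L s (psi (e (f s)))) 0 i.
have prodE x : \prod_(s in S) L s (psi x)
    = \sum_(f in fam) (\prod_(s in S) L s (psi (e (f s))))
                        *+ \prod_(s in S) (x 0%R (f s) : nat).
  transitivity (\prod_(s in S) \sum_k L s (psi (e k)) *+ (x 0%R k : nat)).
    apply: eq_bigr => s _; rewrite {1}[x]row_sum_delta.
    rewrite (big_morph _ (Lpsi s) (Lpsi0 s)); apply: eq_bigr => k _.
    by case: (F2_cases (x 0 k)) => ->; rewrite ?scale0r ?scale1r ?Lpsi0.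
  rewrite (big_distr_big_dep (ord0 : 'I_m.+1)) /=; apply: eq_bigr => f _.
  by rewrite prodrMn.
have prod_img (f : I -> 'I_m.+1) (x : vec m.+1) :
    (\prod_(s in S) (x 0%R (f s) : nat))%N%:R = \prod_(k in f @: S) x 0 k.
  rewrite natr_prod (partition_big_imset f) /=; apply: eq_bigr => k /imsetP[s sS ->].
  rewrite (bigD1 s) ?sS ?eqxx //= natr_Zp.
  case: (F2_cases (x 0 (f s))) => xs; first by rewrite xs mul0r.
  by rewrite big1 ?mulr1 // => t /andP[/andP[_ /eqP->] _]; rewrite natr_Zp.
have coordE x : phi (\prod_(s in S) L s (psi x)) 0 i
    = \sum_(f in fam) co f * \prod_(k in f @: S) x 0 k.
  rewrite prodE raddf_sum summxE; apply: eq_bigr => f _.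
  by rewrite raddfMn mulmxnE -mulr_natr prod_img.
pose c := [ffun J : {set 'I_m.+1} => \sum_(f in fam | f @: S == J) co f].
apply: (@algdeg_leq _ _ c) => [|J].
  apply/forallP => x; rewrite coordE.
  rewrite (partition_big (fun f : {ffun I -> 'I_m.+1} => f @: S) predT) //=.
  apply/eqP/eq_bigr => J _; rewrite ffunE big_distrl /=.
  by apply: eq_bigr => f /andP[_ /eqP->].
rewrite ffunE.
have [/existsP[f /andP[_ /eqP<-]] _|] := boolP [exists f in fam, f @: S == J].
  exact: leq_imset_card.
move=> /existsPn h; rewrite big1 ?eqxx // => f /andP[ff fJ].
by have := h f; rewrite ff fJ.
Qed.

(** * Binary expansions *)

Lemma binary_inj m (b c : nat -> bool) :
  (\sum_(i < m) b i * 2 ^ i = \sum_(i < m) c i * 2 ^ i)%N ->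
  forall i, (i < m)%N -> b i = c i.
Proof.
elim: m b c => // m IH b c.
have E (d : nat -> bool) :
    (\sum_(i < m.+1) d i * 2 ^ i = d 0 + (\sum_(i < m) d i.+1 * 2 ^ i).*2)%N.
  rewrite big_ord_recl muln1 -muln2 big_distrl /=; congr (_ + _)%N.
  by apply: eq_bigr => i _; rewrite /bump add1n expnSr mulnA.
rewrite !E => e; have b0 : b 0 = c 0.
  by have := congr1 odd e; rewrite !oddD !odd_double !addbF !oddb.
case=> // i; rewrite ltnS => im; apply: (IH (fun i => b i.+1) (fun i => c i.+1)) => //.
by apply: double_inj; move: e; rewrite b0 => /addnI.
Qed.

Definition binval n (S : {set 'I_n}) : nat := (\sum_(i in S) 2 ^ i)%N.

Lemma binval_inj n : injective (@binval n).
Proof.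
case: n => [|n] S T; first by move=> _; apply/setP => -[].
have E (R : {set 'I_n.+1}) : binval R = (\sum_(i < n.+1) (inord i \in R) * 2 ^ i)%N.
  rewrite /binval big_mkcond; apply: eq_bigr => i _.
  by rewrite inord_val; case: ifP => _; rewrite ?mul1n.
rewrite !E => eST; apply/setP => i.
have h := @binary_inj _ (fun k => inord k \in S) (fun k => inord k \in T) eST.
by have := h i (ltn_ord i); rewrite !inord_val.
Qed.

Lemma binvalT n : binval [set: 'I_n] = (2 ^ n).-1.
Proof.
rewrite predn_exp mul1n /binval.
by apply: eq_bigl => i; rewrite inE.
Qed.

Lemma binval_lt n (S : {set 'I_n}) : (binval S < 2 ^ n)%N.
Proof.
rewrite -[X in (_ < X)%N]prednK ?expn_gt0 // ltnS -binvalT /binval.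
rewrite big_mkcond [X in (_ <= X)%N]big_mkcond; apply: leq_sum => i _.
by rewrite inE; case: ifP.
Qed.

Lemma binval_onto n k : (k < 2 ^ n)%N -> exists S : {set 'I_n}, binval S = k.
Proof.
move=> hk; pose f (S : {set 'I_n}) : 'I_(2 ^ n) := Ordinal (binval_lt S).
have f_inj : injective f by move=> S T /(congr1 val) /binval_inj.
have [|g _ K] := inj_card_bij f_inj.
  by rewrite card_ord -[#|{set _}|]cardsT -powersetT card_powerset cardsT card_ord.
by exists (g (Ordinal hk)); have /(congr1 val) := K (Ordinal hk).
Qed.

(** * Monomials and the trace over a field of order 2^(n+1) *)

Section BinaryField.

Variables (F : finFieldType) (n : nat).
Hypotheses (pchar2 : 2%N \in [pchar F]) (cardF : #|F| = (2 ^ n.+1)%N).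

Implicit Types (x y : F) (i j : 'I_n.+1) (R S T : {set 'I_n.+1}).

Definition frob i y : F := y ^+ (2 ^ i).

Lemma exp2D k x y : (x + y) ^+ (2 ^ k) = x ^+ (2 ^ k) + y ^+ (2 ^ k).
Proof. by rewrite exprDn_pchar // pnatX pnatE // pchar2. Qed.

Lemma exp2_mod k y : y ^+ (2 ^ (k %% n.+1)) = y ^+ (2 ^ k).
Proof.
rewrite {2}(divn_eq k n.+1); elim: (k %/ n.+1)%N => [|q IH]; first by rewrite mul0n.
by rewrite mulSn -addnA expnD exprM -cardF expf_card.
Qed.

Lemma frobD i : {morph frob i : x y / x + y}.
Proof. exact: exp2D. Qed.

Lemma frobM i : {morph frob i : x y / x * y}.
Proof. by move=> x y; rewrite /frob exprMn. Qed.

Lemma frob0E y : frob 0 y = y.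
Proof. exact: expr1. Qed.

Lemma frob_0 i : frob i 0 = 0.
Proof. by rewrite /frob expr0n expn_eq0. Qed.

Lemma frob_add i j y : frob (i + j) y = frob j (frob i y).
Proof. by rewrite /frob exp2_mod expnD exprM. Qed.

Lemma frob_sum i (I : finType) (P : pred I) (G : I -> F) :
  frob i (\sum_(k | P k) G k) = \sum_(k | P k) frob i (G k).
Proof. exact: (big_morph _ (frobD i) (frob_0 i)). Qed.

Definition mono S y : F := \prod_(i in S) frob i y.

Definition shift j S : {set 'I_n.+1} := [set i | i - j \in S].

Lemma monoE S y : mono S y = y ^+ binval S.
Proof. by rewrite /mono prodrXr. Qed.

Lemma shiftK j : cancel (shift (- j)) (shift j).
Proof. by move=> S; apply/setP => i; rewrite !inE opprK subrK. Qed.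

Lemma card_shift j S : #|shift j S| = #|S|.
Proof.
rewrite -(card_imset S (addIr j)); apply: eq_card => i; rewrite inE.
apply/idP/imsetP => [h|[k kS ->]]; last by rewrite addrK.
by exists (i - j); rewrite ?subrK.
Qed.

Lemma frob_mono j S y : frob j (mono S y) = mono (shift j S) y.
Proof.
rewrite /frob -prodrXl /mono [RHS](reindex_inj (addIr j)) /=.
by apply: eq_big => [i|i _]; rewrite ?inE ?addrK ?frob_add.
Qed.

Lemma mono_morph_frob j S y : mono S (frob j y) = frob j (mono S y).
Proof. by rewrite !monoE /frob -!exprM mulnC. Qed.

(** The exponents of the monomials are the distinct integers below |F|, so a
    vanishing combination is a polynomial of degree less than |F| with |F|
    roots. *)
Lemma mono_free (c : {set 'I_n.+1} -> F) :
  (forall y, \sum_R c R * mono R y = 0) -> forall R, c R = 0.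
Proof.
move=> h R; pose P := \sum_(T : {set 'I_n.+1}) c T *: 'X^(binval T).
have P0 : P = 0.
  apply/eqP; apply/negPn/negP => nP.
  have sP : (size P <= 2 ^ n.+1)%N.
    apply: leq_trans (size_sum _ _ _) _; apply/bigmax_leqP => T _.
    apply: leq_trans (size_scale_leq _ _) _.
    by rewrite size_polyXn binval_lt.
  have /(max_poly_roots nP) : all (root P) (enum F).
    apply/allP => y _; rewrite rootE horner_sum.
    rewrite -[X in _ == X](h y); apply/eqP/eq_bigr => T _.
    by rewrite hornerZ hornerXn monoE.
  by rewrite enum_uniq -cardE cardF => /(_ isT) /leq_trans/(_ sP); rewrite ltnn.
have := coef0 F (binval R); rewrite -P0 coef_sum (bigD1 R) //= big1 ?addr0.
  by rewrite coefZ coefXn eqxx mulr1.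
move=> T nT; rewrite coefZ coefXn (inj_eq (@binval_inj _)) eq_sym (negPf nT).
by rewrite mulr0.
Qed.

Lemma exp_mono d : (0 < d)%N -> exists S, forall y, y ^+ d = mono S y.
Proof.
have [k] := ubnP d; elim: k d => // k IH d dk d0.
have [small|large] := ltnP d (2 ^ n.+1).
  by have [S Sd] := binval_onto small; exists S => y; rewrite monoE Sd.
(* Since y^(2^(n+1)) = y, the exponent may be lowered by 2^(n+1) - 1. *)
have [||S hS] := IH (d - 2 ^ n.+1).+1 => //.
  have : (1 < 2 ^ n.+1)%N by rewrite -[1%N](expn0 2) ltn_exp2l.
  move: large dk; lia.
exists S => y; rewrite -hS exprSr -{3}[y]expf_card cardF -exprD subnK //.
Qed.

Lemma frob_id_eq0 i : (forall y, frob i y = y) -> i = 0.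
Proof.
move=> h; apply/eqP; rewrite -val_eqE /=; apply/negPn/negP => i0.
have [] := negP (oner_neq0 F).
pose c R : F := (R == [set i])%:R - (R == [set 0])%:R.
have E (R0 : {set 'I_n.+1}) y : \sum_R (R == R0)%:R * mono R y = mono R0 y.
  rewrite (bigD1 R0) //= eqxx mul1r big1 ?addr0 // => R /negPf->.
  by rewrite mul0r.
have /mono_free/(_ [set i]) : forall y, \sum_R c R * mono R y = 0.
  move=> y; rewrite (eq_bigr (fun R => (R == [set i])%:R * mono R y
                                    - (R == [set 0])%:R * mono R y)).
    by rewrite sumrB !E /mono !big_set1 h frob0E subrr.
  by move=> R _; rewrite -mulrBl.
rewrite /c eqxx (inj_eq set1_inj) -val_eqE /= (negPf i0) subr0 => /eqP.
by [].
Qed.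

(** A shift of [S] raises y^S to a power of 2, i.e. replaces y by a conjugate,
    which an injective power map only allows for the trivial shift. *)
Lemma shift_fixed_inj S j : injective (mono S) -> shift j S = S -> j = 0.
Proof.
move=> inj fix_S; apply: frob_id_eq0 => y; apply: inj.
by rewrite mono_morph_frob frob_mono fix_S.
Qed.

Definition trace y : F := \sum_i frob i y.

Lemma traceD : {morph trace : x y / x + y}.
Proof. by move=> x y; rewrite -big_split; apply: eq_bigr => i _; rewrite frobD. Qed.

Lemma trace0 : trace 0 = 0.
Proof. by apply: big1 => i _; rewrite frob_0. Qed.

Lemma trace_frob j y : trace (frob j y) = trace y.
Proof.
rewrite /trace [RHS](reindex_inj (addrI j)) /=.
by apply: eq_bigr => i _; rewrite frob_add.
Qed.

Lemma sqr_frob : exists j, forall y, frob j y = y ^+ 2.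
Proof.
by exists (Ordinal (ltn_pmod 1 (ltn0Sn n))) => y; rewrite /frob exp2_mod.
Qed.

Lemma trace_sqr y : trace (y ^+ 2) = trace y.
Proof. by have [j sqE] := sqr_frob; rewrite -sqE trace_frob. Qed.

Lemma trace01 y : trace y = 0 \/ trace y = 1.
Proof.
have [j sqE] := sqr_frob.
have : trace y ^+ 2 = trace y.
  rewrite -[RHS]trace_sqr -!sqE /trace frob_sum; apply: eq_bigr => i _.
  by rewrite -!frob_add addrC.
rewrite expr2 -{3}[trace y]mulr1 => /eqP; rewrite -subr_eq0 -mulrBr mulf_eq0.
by rewrite subr_eq0 => /orP[]/eqP->; [left|right].
Qed.

Lemma trace_nondeg b : (forall y, trace (b * y) = 0) -> b = 0.
Proof.
move=> h; have inj : injective (fun i : 'I_n.+1 => [set i]) by move=> i j /set1_inj.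
pose c R := \sum_(i | [set i] == R) frob i b.
have /mono_free/(_ [set 0]) : forall y, \sum_R c R * mono R y = 0.
  move=> y; rewrite -[RHS](h y) /trace (partition_big (fun i => [set i]) predT) //=.
  apply: eq_bigr => R _; rewrite /c big_distrl /=; apply: eq_bigr => i /eqP<-.
  by rewrite /mono big_set1 frobM.
rewrite /c (big_pred1 0) ?frob0E // => i; exact: (inj_eq inj).
Qed.

(** Expanding (y + 1)^S + y^S over the proper subsets of [S], the coefficient
    of y^R in the trace collects one conjugate of [b] for each shift taking
    [R] into [S]. *)
Lemma trace_deriv_coef S b k :
    (forall y, trace (b * (mono S (y + 1) + mono S y)) = k) ->
  forall R, R != set0 -> \sum_(j | shift (- j) R \proper S) frob j b = 0.
Proof.
move=> h.
have monoD1 y : mono S (y + 1) + mono S y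
    = \sum_(T : {set 'I_n.+1} | T \proper S) mono T y.
  have -> : mono S (y + 1) = \sum_(T : {set 'I_n.+1} | T \subset S) mono T y.
    rewrite /mono big_mkcond /=.
    rewrite (eq_bigr (fun i => (if i \in S then frob i y else 0) + 1)); last first.
      by move=> i _; rewrite frobD; case: ifP; rewrite ?add0r // /frob expr1n.
    rewrite bigA_distr [RHS]big_mkcond; apply: eq_bigr => T _ /=.
    rewrite -big_mkcond /=.
    case: ifP => [/subsetP TS|/subsetPn[i iT nS]].
      by apply: eq_bigr => i /TS ->.
    by rewrite (bigD1 i) //= (negPf nS) mul0r.
  rewrite (bigD1 S) //= addrAC addrr_pchar2 // add0r.
  by apply: eq_bigl => T; rewrite properEneq andbC.
have E y : k = \sum_R (\sum_(j | shift (- j) R \proper S) frob j b) * mono R y.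
  rewrite -(h y) monoD1 /trace.
  transitivity (\sum_j \sum_(R | shift (- j) R \proper S) frob j b * mono R y).
    apply: eq_bigr => j _; rewrite frobM frob_sum big_distrr /=.
    rewrite (reindex_inj (can_inj (shiftK j))) /=.
    by apply: eq_bigr => R _; rewrite frob_mono shiftK.
  rewrite (exchange_big_dep predT) //=; apply: eq_bigr => R _.
  by rewrite big_distrl.
move=> R nR.
pose c T := \sum_(j | shift (- j) T \proper S) frob j b - k * (T == set0)%:R.
have /mono_free/(_ R) : forall y, \sum_R c R * mono R y = 0.
  move=> y; rewrite (eq_bigr (fun R =>
      (\sum_(j | shift (- j) R \proper S) frob j b) * mono R y
      - (k * (R == set0)%:R) * mono R y)) => [|T _]; last by rewrite -mulrBl.
  rewrite sumrB -E (bigD1 set0) //= eqxx mulr1 /mono big_set0 mulr1.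
  rewrite big1 ?addr0 ?subrr // => T /negPf->; by rewrite mulr0 mul0r.
by rewrite /c (negPf nR) mulr0 subr0.
Qed.

(** For b = 1 the coefficients in [trace_deriv_coef] count shifts modulo 2, so
    every non-empty set has an even number of shifts properly inside [S].  If
    #|S| > 2, singletons make #|S| even and pairs make #|S :&: shift r S| even
    for r <> 0; applied to [S :\ s], a non-trivial shift into [S] exists, so
    that #|S :&: shift r S| >= #|S| - 1 for some r <> 0, and parity forces [S]
    to be invariant under the shift by [r], against [shift_fixed_inj]. *)
Lemma crooked_mono_quadratic S k : injective (mono S) ->
    (forall y, trace (mono S (y + 1) + mono S y) = k) -> (#|S| <= 2)%N.
Proof.
move=> inj h; rewrite leqNgt; apply/negP => S3.
pose N R := #|[set j | shift (- j) R \proper S]|.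
have Neven R : R != set0 -> ~~ odd (N R).
  move=> nR; have /trace_deriv_coef/(_ R nR) : 
      forall y, trace (1 * (mono S (y + 1) + mono S y)) = k.
    by move=> y; rewrite mul1r.
  rewrite (eq_bigr (fun=> 1)) => [|j _]; last by rewrite /frob expr1n.
  rewrite sumr_const => /eqP; rewrite -(dvdn_pcharf pchar2) dvdn2.
  by rewrite /N cardsE.
have properS R j : (#|R| < #|S|)%N ->
    (shift (- j) R \proper S) = (shift (- j) R \subset S).
  by move=> RS; rewrite properEcard card_shift RS andbT.
have Sodd : ~~ odd #|S|.
  have -> : #|S| = N [set 0].
    rewrite /N -(card_imset S oppr_inj); apply: eq_card => j.
    rewrite inE properS ?cards1 ?(ltn_trans _ S3) //.
    rewrite (_ : shift (- j) [set 0] = [set - j]).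
      rewrite sub1set; apply/imsetP/idP => [[i iS ->]|]; first by rewrite opprK.
      by exists (- j); rewrite ?opprK.
    by apply/setP => i; rewrite !inE opprK addr_eq0.
  by apply: Neven; apply/set0Pn; exists 0; rewrite inE.
have pair r : r != 0 -> ~~ odd #|[set i in S | i + r \in S]|.
  move=> nr; have -> : #|[set i in S | i + r \in S]| = N [set 0; r].
    rewrite /N -(card_imset _ oppr_inj); apply: eq_card => j.
    rewrite inE properS ?cards2 ?(eq_sym 0) ?nr //.
    rewrite (_ : shift (- j) [set 0; r] = [set - j; - j + r]).
      rewrite subUset !sub1set; apply/imsetP/idP => [[i]|].
        by rewrite inE => iS ->; rewrite opprK.
      by exists (- j); rewrite ?opprK ?inE.
    apply/setP => i; rewrite !inE opprK addr_eq0 addrC.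
    by rewrite -[_ == r](inj_eq (addrI (- j))) addKr.
  by apply: Neven; apply/set0Pn; exists 0; rewrite !inE eqxx.
have [s sS] : exists s, s \in S by apply/set0Pn; rewrite -card_gt0 (ltn_trans _ S3).
have cS : #|S| = #|S :\ s|.+1 by rewrite (cardsD1 s S) sS.
have nSs : S :\ s != set0 by rewrite -card_gt0; move: S3; rewrite cS; lia.
have [j nj jS] : exists2 j, j != 0 & shift (- j) (S :\ s) \subset S.
  have shift0 R : shift (- 0) R = R by apply/setP => i; rewrite inE !oppr0 addr0.
  have N0 : 0 \in [set j | shift (- j) (S :\ s) \proper S].
    by rewrite inE shift0 properEcard subsetDl cS /=.
  have := Neven _ nSs; rewrite /N (cardsD1 0) N0 /= negbK => od.
  have : (0 < #|[set j | shift (- j) (S :\ s) \proper S] :\ 0%R|)%N.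
    by move: od; case: #|_|.
  rewrite card_gt0 => /set0Pn[j]; rewrite !inE => /andP[nj /proper_sub jS].
  by exists j.
have big_inter : (#|S :\ s| <= #|[set i in S | (i + j)%R \in S]|)%N.
  rewrite -(card_shift (- j)); apply: subset_leq_card; apply/subsetP => i iS.
  rewrite inE (subsetP jS _ iS) /=; move: iS; rewrite !inE opprK.
  by case/andP.
have inv i : i \in S -> i + j \in S.
  have sub : [set i in S | (i + j)%R \in S] \subset S.
    by apply/subsetP => k'; rewrite inE => /andP[].
  have /eqP eS : [set i in S | (i + j)%R \in S] == S.
    rewrite eqEcard sub /= leqNgt; apply/negP => lt.
    have := pair j nj; move: Sodd big_inter lt; rewrite cS ltnS /= => o1 le1 le2.
    rewrite (_ : #|_| = #|S :\ s|); first exact/negP.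
    by apply/eqP; rewrite eqn_leq le2.
  by rewrite -{1}eS inE => /andP[].
suff /(shift_fixed_inj inj) j0 : shift j S = S by rewrite j0 eqxx in nj.
apply/esym/eqP; rewrite eq_sym eqEcard card_shift leqnn andbT.
by apply/subsetP => i; rewrite inE => /inv; rewrite subrK.
Qed.

(** For S the complement of {0}, a set [R] of at most n - 1 indices has its
    shift inside [S] exactly for the shifts outside [R]; the complements of
    {0, 1} and {0, 1, 2} then give b + b^2 = 0 and b + b^2 + b^4 = 0. *)
Lemma inverse_trace_coef b k : (3 <= n)%N ->
    (forall y, trace (b * (mono [set~ 0] (y + 1) + mono [set~ 0] y)) = k) ->
  b = 0.
Proof.
move=> n3 h.
have coef R : R != set0 -> (1 < #|~: R|)%N -> \sum_(j in ~: R) frob j b = 0.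
  move=> nR cR; rewrite -[RHS](trace_deriv_coef h nR); apply: eq_bigl => j.
  rewrite properEcard card_shift cardsC1 card_ord.
  have -> : (#|R| < n)%N.
    by move: cR; have := cardsC R; rewrite card_ord; lia.
  rewrite andbT inE; apply/idP/subsetP => [jR i|sub].
    by rewrite !inE opprK; apply: contraTneq => ->; rewrite add0r.
  apply/negP => jR; have := sub 0; rewrite !inE opprK add0r eqxx.
  by move=> /(_ jR).
pose i1 : 'I_n.+1 := inord 1; pose i2 : 'I_n.+1 := inord 2.
have v1 : i1 = 1%N :> nat by rewrite inordK // ltnS (ltn_trans _ n3).
have v2 : i2 = 2%N :> nat by rewrite inordK // ltnS (ltn_trans _ n3).
have d01 : 0 \notin [set i1] by rewrite inE -val_eqE /= v1.
have d12 : i1 \notin [set i2] by rewrite inE -val_eqE /= v1 v2.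
have d012 : 0 \notin [set i1; i2] by rewrite !inE -!val_eqE /= v1 v2.
have nonempty (D : {set 'I_n.+1}) : (#|D| <= 3)%N -> ~: D != set0.
  by move=> cD; rewrite -card_gt0; have := cardsC D; rewrite card_ord; lia.
have e1 : frob 0 b + frob i1 b = 0.
  have := coef (~: (0 |: [set i1])); rewrite setCK big_setU1 //= big_set1.
  by apply; [apply: nonempty|]; rewrite cardsU1 d01 cards1.
have e2 : frob 0 b + (frob i1 b + frob i2 b) = 0.
  have := coef (~: (0 |: (i1 |: [set i2]))); rewrite setCK !big_setU1 //= big_set1.
  by apply; [apply: nonempty|]; rewrite cardsU1 d012 cards2; case: (i1 != i2).
move: e2; rewrite addrA e1 add0r => /eqP.
by rewrite /frob expf_eq0 => /andP[_ /eqP].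
Qed.

(** * The field model of F_2^(n+1) *)

Variables (phi : {additive F -> vec n.+1}) (psi : vec n.+1 -> F).
Hypotheses (phiK : cancel phi psi) (psiK : cancel psi phi).

Lemma psiD : {morph psi : x y / x + y}.
Proof. by move=> x y; rewrite -[RHS]phiK raddfD /= !psiK. Qed.

(** The vector representing the linear form y |-> Tr(b y) through [phi]; [phi]
    being arbitrary, it need not be [phi b]. *)
Definition tracevec b : vec n.+1 :=
  \row_i (if trace (b * psi (delta_mx 0 i)) == 0 then 0 else 1).

Definition F2emb (c : 'F_2) : F := c%:R.

Lemma F2embD : {morph F2emb : c d / c + d}.
Proof.
move=> c d; case: (F2_cases c) => ->; case: (F2_cases d) => ->;
  rewrite ?add0r ?addr0 //.
by rewrite addFF (addrr_pchar2 pchar2).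
Qed.

(** Scalar products through [phi] are traces of products: both sides are
    additive in y and agree on the basis. *)
Lemma trace_tracevec b y : trace (b * y) = F2emb (dot (tracevec b) (phi y)).
Proof.
have trD : {morph (fun x => trace (b * x)) : x y / x + y}.
  by move=> x z; rewrite mulrDr traceD.
have psi0 : psi 0 = 0 by rewrite -(raddf0 phi) phiK.
rewrite -{1}[y]phiK; move: (phi y) => v.
rewrite {1}[v]row_sum_delta (big_morph _ psiD psi0).
have trD0 : trace (b * 0) = 0 by rewrite mulr0 trace0.
rewrite (big_morph _ trD trD0).
rewrite /dot (big_morph _ F2embD (erefl _)); apply: eq_bigr => i _; rewrite mxE.
case: (F2_cases (v 0 i)) => ->; first by rewrite scale0r psi0 mulr0 trace0 mulr0.
rewrite scale1r mulr1; case: eqP => [-> //|].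
by case: (trace01 (b * psi (delta_mx 0 i))) => ->.
Qed.

Lemma F2emb_inj : injective F2emb.
Proof.
move=> c d; case: (F2_cases c) => ->; case: (F2_cases d) => -> //.
  by move=> /esym/eqP; rewrite oner_eq0.
by move=> /eqP; rewrite oner_eq0.
Qed.

Lemma tracevec_inj : injective tracevec.
Proof.
move=> b d e; apply/eqP; rewrite -subr_eq0; apply/eqP/trace_nondeg => y.
rewrite mulrDl mulNr traceD (oppr_pchar2 pchar2) !trace_tracevec e.
by rewrite (addrr_pchar2 pchar2).
Qed.

Lemma tracevec0 : tracevec 0 = 0.
Proof. by apply/rowP => i; rewrite !mxE mul0r trace0 eqxx. Qed.

Lemma tracevec_onto v : exists b, tracevec b = v.
Proof.
have [|g _ K] := inj_card_bij tracevec_inj; first by rewrite card_vec cardF.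
by exists (g v).
Qed.

Lemma tracevec_neq0 b : (tracevec b != 0) = (b != 0).
Proof. by rewrite -{1}tracevec0 (inj_eq tracevec_inj). Qed.

(** Substituting y = a z turns a derivative of y^S in direction a into the
    derivative in direction 1. *)
Lemma linear_structure_field (p : vec n.+1 -> vec n.+1) S (c : 'F_2) (a b : vec n.+1) :
    (forall y, p (phi y) = phi (mono S y)) -> a != 0 -> b != 0 ->
    (forall y : vec n.+1, dot b (p (y + a) + p y) = c) ->
  exists2 d, d != 0 & forall y, trace (d * (mono S (y + 1) + mono S y)) = F2emb c.
Proof.
move=> pS na nb h; have [e eb] := tracevec_onto b; rewrite -eb in nb h.
have na' : psi a != 0.
  by apply: contra na => /eqP a0; rewrite -[a]psiK a0 raddf0.
have monoM y z : mono S (y * z) = mono S y * mono S z by rewrite !monoE exprMn.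
exists (e * mono S (psi a)).
  by apply: mulf_neq0; [rewrite -tracevec_neq0 | rewrite monoE expf_neq0].
move=> y; rewrite -(h (phi (y * psi a))).
have -> : phi (y * psi a) + a = phi ((y + 1) * psi a).
  by rewrite mulrDl mul1r raddfD /= psiK.
by rewrite !pS -raddfD -trace_tracevec !monoM -mulrDl mulrAC -mulrA.
Qed.

Lemma monomial_mono (p : {perm vec n.+1}) : monomial phi p ->
  exists2 S, injective (mono S) & forall y, p (phi y) = phi (mono S y).
Proof.
case=> d pd; have d0 : (0 < d)%N.
  rewrite lt0n; apply/eqP => d0; have := oner_neq0 F.
  have /perm_inj/(can_inj phiK)-> : p (phi 1) = p (phi 0) by rewrite !pd d0 !expr0.
  by rewrite eqxx.
have [S Sd] := exp_mono d0; have pS y : p (phi y) = phi (mono S y) by rewrite pd Sd.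
exists S => // x y e; apply: (can_inj phiK); apply: (@perm_inj _ p).
by rewrite !pS e.
Qed.

Lemma map_deg_mono (p : vec n.+1 -> vec n.+1) S :
  (forall y, p (phi y) = phi (mono S y)) -> (map_deg p <= #|S|)%N.
Proof.
move=> pS; have := @map_deg_prod_additive n F phi psi _ S frob psiD frobD.
rewrite (_ : map_deg (fun x : vec n.+1 => _) = map_deg p) //.
apply: eq_bigr => i _; apply: eq_bigl => I; apply: eq_existsb => c.
congr (_ && _); apply: eq_forallb => x.
by rewrite (_ : p x = phi (mono S (psi x))) // -pS psiK.
Qed.

(** A constant component derivative b . D_a p = 1 becomes
    Tr(d ((y + 1)^S + y^S)) = 1 for some d <> 0.  Squaring shows that d^2 works
    as well, so Tr((d + d^2) ((y + 1)^S + y^S)) = 0, which the counting argument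
    for APN permutations excludes unless d = d^2, that is d = 1. *)
Lemma monomial_APN_no_linear_structure (p : {perm vec n.+1}) c :
  monomial phi p -> APN p -> (2 < map_deg p)%N -> no_linear_structure p c.
Proof.
move=> mon apn deg a b na nb; case: (F2_cases c) => -> h.
  exact: (APN_no_linear_structure0 apn na nb).
have [S S_inj pS] := monomial_mono mon.
have [d nd hd] := linear_structure_field pS na nb h.
have d2 : d = d ^+ 2.
  apply/eqP; rewrite -subr_eq0 (oppr_pchar2 pchar2); apply/negPn/negP => nd2.
  have n1 : phi 1 != 0 by rewrite -(raddf0 phi) (inj_eq (can_inj phiK)) oner_eq0.
  rewrite -tracevec_neq0 in nd2.
  apply: (APN_no_linear_structure0 apn n1 nd2) => y; apply: F2emb_inj.
  rewrite -[y]psiK -raddfD /= !pS -raddfD -trace_tracevec mulrDl traceD hd.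
  have [j sqE] := sqr_frob.
  have [z zy] : exists z, psi y = frob j z.
    have frob_inj : injective (frob j).
      move=> u v; rewrite !sqE => /eqP; rewrite eqf_sqr (oppr_pchar2 pchar2) orbb.
      by move/eqP.
    by have [g _ K] := injF_bij frob_inj; exists (g (psi y)).
  have zy1 : psi y + 1 = frob j (z + 1) by rewrite frobD -zy /frob expr1n.
  rewrite zy1 zy !mono_morph_frob -sqE -frobD -frobM trace_frob hd.
  by rewrite (addrr_pchar2 pchar2).
have d1 : d = 1.
  by apply: (mulfI nd); rewrite mulr1 -expr2 -d2.
have := crooked_mono_quadratic S_inj (k := F2emb 1).
rewrite leqNgt (leq_trans deg (map_deg_mono pS)) => /(_ _)/notF; apply=> y.
by rewrite -(hd y) d1 mul1r.
Qed.

(** * The inverse function *)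

Lemma mono_inverse y : (0 < n)%N -> mono [set~ 0] y = y^-1.
Proof.
move=> n0; have [->|ny] := eqVneq y 0.
  rewrite invr0 /mono (bigD1 (ord_max : 'I_n.+1)) /=; first by rewrite frob_0 mul0r.
  by rewrite !inE -val_eqE /= -lt0n.
apply: (mulfI ny); rewrite mulfV //.
have -> : y * mono [set~ 0] y = mono setT y.
  rewrite /mono [RHS](bigD1 0) ?inE //= frob0E; congr (_ * _).
  by apply: eq_bigl => i; rewrite !inE.
apply: (mulfI ny); rewrite mulr1 monoE binvalT -exprS prednK ?expn_gt0 //.
by rewrite -cardF expf_card.
Qed.

(** The linearized polynomial with kernel {0, a}, in characteristic 2. *)
Definition kerpoly (a y : F) : F := y * (y + a).

Lemma kerpolyD a : {morph kerpoly a : x y / x + y}.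
Proof.
move=> x y; rewrite /kerpoly.
have -> : (x + y) * (x + y + a) = x * (x + a) + y * (y + a) + (x * y + x * y) by ring.
by rewrite (addrr_pchar2 pchar2) addr0.
Qed.

Lemma kerpoly_eq0 a y : (kerpoly a y == 0) = (y == 0) || (y == a).
Proof. by rewrite mulf_eq0 addr_eq0 (oppr_pchar2 pchar2). Qed.

Lemma inv_D1 a y : kerpoly a y != 0 -> (y + a)^-1 + y^-1 = a / kerpoly a y.
Proof.
rewrite mulf_eq0 negb_or => /andP[ny nya].
rewrite -[(y + a)^-1]mul1r -[y^-1]mul1r addf_div // !mul1r /kerpoly addrA.
by rewrite (addrr_pchar2 pchar2) add0r [(y + a) * y]mulrC.
Qed.

Lemma kerpoly_comp a b y :
  kerpoly (kerpoly a b) (kerpoly a y) = kerpoly a y * kerpoly a (y + b).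
Proof. by rewrite [kerpoly a (y + b)]kerpolyD. Qed.

Lemma kerpoly2_eq0 a b y : (kerpoly (kerpoly a b) (kerpoly a y) == 0)
  = (y \in [:: 0; a; b; a + b]).
Proof.
rewrite kerpoly_comp mulf_eq0 !kerpoly_eq0 !inE -!orbA.
by rewrite -{1 2}[b](oppr_pchar2 pchar2) !subr_eq add0r.
Qed.

(** Each derivative of the inverse composes one more [kerpoly] below the
    fraction line: the values of the linearized polynomial are translated by a
    constant when y is, and the previous identity applies again. *)
Lemma inv_D2 a b y : kerpoly (kerpoly a b) (kerpoly a y) != 0 ->
  (y + a + b)^-1 + (y + a)^-1 + (y + b)^-1 + y^-1
    = a * kerpoly a b / kerpoly (kerpoly a b) (kerpoly a y).
Proof.
move=> nz; have /andP[ny nyb] : (kerpoly a y != 0) && (kerpoly a (y + b) != 0).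
  by rewrite -negb_or -mulf_eq0 -kerpoly_comp.
rewrite -mulrA -inv_D1 // -kerpolyD mulrDr -!inv_D1 // (addrAC y a b).
ring.
Qed.

Lemma inv_D3 a b c y (Q := fun x => kerpoly (kerpoly a b) (kerpoly a x)) :
    kerpoly (Q c) (Q y) != 0 ->
  (y + c + a + b)^-1 + (y + c + a)^-1 + (y + c + b)^-1 + (y + c)^-1
    + ((y + a + b)^-1 + (y + a)^-1 + (y + b)^-1 + y^-1)
  = a * kerpoly a b * Q c / kerpoly (Q c) (Q y).
Proof.
have QD x z : Q (x + z) = Q x + Q z by rewrite /Q !kerpolyD.
move=> nz; have /andP[ny nyc] : (Q y != 0) && (Q (y + c) != 0).
  by rewrite -negb_or -mulf_eq0 QD.
rewrite !inv_D2 // -/(Q y) -/(Q (y + c)) -[RHS]mulrA.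
by rewrite -[X in _ = _ * X]inv_D1 // -QD mulrDr.
Qed.

Section InversePermutation.

Variable p : {perm vec n.+1}.
Hypotheses (n3 : (3 <= n)%N) (pE : forall y, p (phi y) = phi y^-1).

Lemma psi_eq0 (v : vec n.+1) : (psi v == 0) = (v == 0).
Proof. by rewrite -(inj_eq (can_inj phiK)) psiK raddf0. Qed.

Lemma inverse_psi (v : vec n.+1) : p v = phi (psi v)^-1.
Proof. by rewrite -pE psiK. Qed.


Let card16 : (16 <= #|F|)%N.
Proof. by rewrite cardF (leq_pexp2l (m := 2) (n1 := 4)). Qed.

Lemma inverse_no_flat_pair : no_flat_pair p.
Proof.
move=> a b na nb nab h.
have [y ny] : exists y, y \notin [:: 0; psi a; psi b; psi a + psi b].
  by apply: exists_notin; apply: leq_trans card16.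
rewrite -kerpoly2_eq0 in ny.
have := h (phi y); rewrite !inverse_psi !psiD phiK -!raddfD inv_D2 //.
apply/eqP; rewrite -psi_eq0 phiK mulf_neq0 ?invr_eq0 // mulf_neq0 ?psi_eq0 //.
by rewrite kerpoly_eq0 negb_or psi_eq0 nb (inj_eq (can_inj psiK)) eq_sym.
Qed.

Lemma inverse_map_deg : (2 < map_deg p)%N.
Proof.
rewrite ltnNge; apply/negP => deg.
pose a : F := 1.
have na : a != 0 by exact: oner_neq0.
have [b] : exists b, b \notin [:: 0; a].
  by apply: exists_notin; apply: leq_trans card16.
rewrite !inE -kerpoly_eq0 => nB.
have [c] : exists c, c \notin [:: 0; a; b; a + b].
  by apply: exists_notin; apply: leq_trans card16.
rewrite -kerpoly2_eq0 => nC.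
pose s := [:: 0; a; b; a + b].
have [y] : exists y, y \notin s ++ [seq t + c | t <- s].
  by apply: exists_notin; apply: leq_trans card16.
rewrite mem_cat negb_or -(kerpoly2_eq0 a b) => /andP[ny nyc].
have {nyc} : y + c \notin s.
  apply: contra nyc => yc; apply/mapP; exists (y + c) => //.
  by rewrite -addrA (addrr_pchar2 pchar2) addr0.
rewrite -kerpoly2_eq0 => nyc.
pose Q x := kerpoly (kerpoly a b) (kerpoly a x).
have nQ : kerpoly (Q c) (Q y) != 0.
  have -> : kerpoly (Q c) (Q y) = Q y * Q (y + c) by rewrite /Q !kerpolyD.
  by rewrite mulf_neq0.
have := D3_map_deg2 (phi a) (phi b) (phi c) (phi y) deg.
rewrite !inverse_psi !psiD !phiK -!raddfD inv_D3 //.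
apply/eqP; rewrite -psi_eq0 phiK mulf_neq0 ?invr_eq0 //.
by rewrite mulf_neq0 // mulf_neq0.
Qed.

(** A primitive cube root of unity is fixed by squaring twice but not once, hence
    not by n + 1 squarings when n + 1 is odd. *)
Lemma no_cube_root z : odd n.+1 -> kerpoly 1 z <> 1.
Proof.
move=> odd_m hz.
have z2 : z ^+ 2 = z + 1.
  by rewrite -hz /kerpoly mulrDr mulr1 addrCA (addrr_pchar2 pchar2) addr0 expr2.
have z4 : z ^+ 4 = z.
  rewrite (exprM z 2 2) z2 (exp2D 1) expr1n z2.
  by rewrite -addrA (addrr_pchar2 pchar2) addr0.
have zk k : z ^+ (2 ^ (2 * k).+1) = z + 1.
  elim: k => [|k IH]; first by rewrite muln0.
  by rewrite mulnS -addnS expnD exprM -[(2 ^ 2)%N]/4%N z4.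
have := expf_card z; rewrite cardF -(odd_double_half n.+1) odd_m add1n -mul2n zk.
by rewrite -{2}[z]addr0 => /addrI/eqP; rewrite oner_eq0.
Qed.

(** Away from {0, a} the derivative is a / (y (y + a)), which is two-to-one; it
    can only take the value 1/a of the points 0 and a if y/a is a primitive
    cube root of unity. *)
Lemma inverse_APN : odd n.+1 -> APN p.
Proof.
move=> odd_m; apply: APN_of_inj => a x y na E.
have na' : psi a != 0 by rewrite psi_eq0.
have {}E : (psi x + psi a)^-1 + (psi x)^-1 = (psi y + psi a)^-1 + (psi y)^-1.
  by apply: (can_inj phiK); rewrite !raddfD /= -!psiD -!inverse_psi.
have key u v : kerpoly (psi a) u = 0 -> kerpoly (psi a) v != 0 ->
    (u + psi a)^-1 + u^-1 <> (v + psi a)^-1 + v^-1.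
  move=> u0 nv; rewrite (inv_D1 nv) => e.
  have ua : (u + psi a)^-1 + u^-1 = (psi a)^-1.
    move/eqP: u0; rewrite kerpoly_eq0 => /orP[]/eqP->.
      by rewrite add0r invr0 addr0.
    by rewrite (addrr_pchar2 pchar2) invr0 add0r.
  apply: (no_cube_root (z := v / psi a) odd_m).
  have -> : kerpoly 1 (v / psi a) = kerpoly (psi a) v / (psi a * psi a).
    by rewrite /kerpoly; field.
  have -> : kerpoly (psi a) v = psi a * psi a.
    apply/eqP; rewrite -[kerpoly _ _]mul1r -(eqr_div _ _ na' nv) mul1r.
    by rewrite -e ua.
  by rewrite divff // mulf_neq0.
have pair u v : kerpoly (psi a) (u + v) = 0 -> v = u \/ v = u + psi a.
  move/eqP; rewrite kerpoly_eq0 addr_eq0 (oppr_pchar2 pchar2) => /orP[/eqP->|/eqP<-].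
    by left.
  by right; rewrite addrA (addrr_pchar2 pchar2) add0r.
suff /pair : kerpoly (psi a) (psi x + psi y) = 0.
  by rewrite -psiD => -[] /(can_inj psiK) ->; [left|right].
rewrite kerpolyD; have [x0|nx] := eqVneq (kerpoly (psi a) (psi x)) 0.
  have [->|ny] := eqVneq (kerpoly (psi a) (psi y)) 0; first by rewrite x0 addr0.
  by have := key _ _ x0 ny E.
have [y0|ny] := eqVneq (kerpoly (psi a) (psi y)) 0.
  by have := key _ _ y0 nx (esym E).
move: E; rewrite !inv_D1 // => /(mulfI na')/invr_inj ->.
by rewrite (addrr_pchar2 pchar2).
Qed.

Lemma inverse_monomial : monomial phi p.
Proof.
exists (binval [set~ (0 : 'I_n.+1)]) => y.
by rewrite pE -monoE mono_inverse // (leq_trans _ n3).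
Qed.

Lemma inverse_involutive : (p^-1)%g = p.
Proof.
apply/permP => x; apply: (@perm_inj _ p); rewrite permKV.
by rewrite -[x]psiK !pE invrK.
Qed.

Lemma inverse_no_linear_structure c : no_linear_structure p c.
Proof.
move=> a b na nb h.
have pS y : p (phi y) = phi (mono [set~ 0] y).
  by rewrite pE mono_inverse // (leq_trans _ n3).
have [d nd hd] := linear_structure_field pS na nb h.
by rewrite (inverse_trace_coef n3 hd) eqxx in nd.
Qed.

End InversePermutation.

End BinaryField.

(** * Duals for monomial APN permutations and for the inverse function *)

Theorem theorem6p11 (m : nat) (hm : (4 <= m)%N) (F : finFieldType)
    (phi : {additive F -> vec m}) (hphi : bijective phi) :
  (forall p : {perm vec m},
     monomial phi p -> APN p -> (2 < map_deg p)%N ->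
     l_optimal (bent_of p) ->
     (2 < map_deg (p^-1)%g)%N ->
     forall fs : boolfun (m + m), is_dual (bent_of p) fs ->
       l_optimal fs /\ only_five_valued fs)
  /\
  (exists p : {perm vec m},
     (forall y : F, p (phi y) = phi (y^-1)) /\
     monomial phi p /\
     (odd m -> APN p) /\
     (2 < map_deg p)%N /\
     l_optimal (bent_of p) /\
     (2 < map_deg (p^-1)%g)%N /\
     forall fs : boolfun (m + m), is_dual (bent_of p) fs ->
       l_optimal fs /\ only_five_valued fs).
Proof.
case: m hm phi hphi => // n hm phi [psi phiK psiK].
have n3 : (3 <= n)%N by [].
have cardF : #|F| = (2 ^ n.+1)%N.
  by rewrite -card_vec; apply: bij_eq_card (Bijective phiK psiK).
have pchar2 : 2%N \in [pchar F].
  rewrite inE /=; apply/eqP/(can_inj phiK).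
  by rewrite raddf0 mulr2n raddfD vecDD.
split=> [p mon apn deg _ _ fs|].
  apply: dual_optimal_five_valued => //.
  - exact: APN_no_flat_pair.
  - by move=> c; apply: (monomial_APN_no_linear_structure pchar2 cardF phiK psiK).
  - exact/APN_no_flat_pair/APN_inv.
  - exact/APN_no_linear_structure0/APN_inv.
have inj : injective (fun x => phi (psi x)^-1).
  by move=> x y /(can_inj phiK)/invr_inj/(can_inj psiK).
pose p := perm inj; have pE y : p (phi y) = phi y^-1 by rewrite permE phiK.
have pV := inverse_involutive psiK pE.
have flat := inverse_no_flat_pair pchar2 cardF phiK psiK n3 pE.
have lin c := inverse_no_linear_structure pchar2 cardF phiK psiK n3 pE (c := c).
have deg := inverse_map_deg pchar2 cardF phiK psiK n3 pE.
exists p; split=> //; split; first exact: (inverse_monomial cardF n3 pE).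
split; first exact: (inverse_APN pchar2 cardF phiK psiK pE).
split=> //; split; first exact: bent_of_optimal.
split; first by rewrite pV.
by move=> fs; apply: dual_optimal_five_valued; rewrite ?pV.
Qed.
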